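(* Let $K$ be a field, let $L=L_K(R_2)$, and let $C=(\gamma_1,\ldots,\gamma_n)$ be an ordered leaf set in the rooted binary tree with $n\geq 2$. Then $$L^\times=\Theta_C\bigl(E_n(L)\bigr)=\left\langle 1+\gamma_i a\gamma_j^* : a\in L,\ i\neq j\right\rangle .$$ In particular, $$L^\times=\left\langle 1+eaf^*,\ 1+fbe^* : a,b\in L\right\rangle .$$
   Context: $L=L_K(R_2)$ is the unital associative $K$-algebra generated by $e,f,e^*,f^*$ subject to $e^*e=f^*f=1$, $e^*f=f^*e=0$, $ee^*+ff^*=1$. A word $\alpha=x_1\cdots x_r$ in the free monoid $\{e,f\}^*$ (with empty word $1$) is viewed as an element of $L$, and $\alpha^*=x_r^*\cdots x_1^*$, $1^*=1$. The rooted binary tree has vertex set $\{e,f\}^*$, root $1$, and $\gamma$ has children $\gamma e,\gamma f$. A finite rooted subtree is full if it contains the root, is closed under prefixes, and each of its vertices has either both children or no child in it. A leaf set is the set of leaves of such a finite full subtree; equivalently, it is obtained from $\{1\}$ by finitely many simple expansions, each replacing an element $\gamma$ by $\gamma e,\gamma f$. An ordered leaf set is an ordering $(\gamma_1,\ldots,\gamma_n)$ of a leaf set. For such $C$, $\Theta_C:M_n(L)\to L$ is the unital $K$-algebra isomorphism $\Theta_C((a_{ij}))=\sum_{i,j}\gamma_i a_{ij}\gamma_j^*$. $E_n(L)$ is the subgroup of $\mathrm{GL}_n(L)$ generated by the elementary matrices $I_n+aE_{ij}$, $i\neq j$, $a\in L$. For a ring $R$, $R^\times$ denotes its unit group. 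*)

(* Defs.v *)
From HB Require Import structures.
From mathcomp Require Import all_boot all_order all_algebra.
From mathcomp Require Import finmap.
From mathcomp Require Import boolp classical_sets.

Set Implicit Arguments.
Unset Strict Implicit.
Unset Printing Implicit Defensive.

Import GRing.Theory.
Local Open Scope classical_set_scope.
Local Open Scope ring_scope.

(* A word over {e, f} is read from left to right, with e = false and f = true;
   the children of the vertex g are rcons g false and rcons g true. *)
Definition word := seq bool.

Definition full_subtree (T : {fset word}) : Prop :=
  [/\ [::] \in T,
      forall g h : word, prefix g h -> h \in T -> g \in T
    & forall g : word, g \in T -> (rcons g false \in T) = (rcons g true \in T)].

Definition leaves (T : {fset word}) : {fset word} :=
  [fset g in T | (rcons g false \notin T) && (rcons g true \notin T)]%fset.

Definition ordered_leaf_set (C : seq word) : Prop :=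
  uniq C /\ exists2 T : {fset word}, full_subtree T & C =i leaves T.

(* The subgroup generated by a set S of units of R. Inverses are taken through
   the two-sided equations, because square matrices over a noncommutative ring
   have no unitRingType structure. *)
Inductive generated_subgroup (R : pzRingType) (S : set R) : set R :=
| gen_one : generated_subgroup S 1
| gen_incl x of S x : generated_subgroup S x
| gen_mul x y of generated_subgroup S x & generated_subgroup S y :
    generated_subgroup S (x * y)
| gen_inv x y of generated_subgroup S x & x * y = 1 & y * x = 1 :
    generated_subgroup S y.

#[global] Arguments generated_subgroup {R} S _.

Definition elementary_matrices (R : pzRingType) (n : nat) : set 'M[R]_n :=
  [set A | exists i j : 'I_n, exists a : R,
     i != j /\ A = 1%:M + a *: delta_mx i j].

Definition elementary_group (R : pzRingType) (n : nat) : set 'M[R]_n :=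
  generated_subgroup (@elementary_matrices R n).

#[global] Arguments elementary_matrices R n _ : clear implicits.
#[global] Arguments elementary_group R n _ : clear implicits.

(* The Leavitt algebra L_K(R_2) is built from its presentation: formal
   expressions in e, f, e^*, f^* modulo the least congruence containing the
   axioms of associative unital K-algebras and the five defining relations.
   leavitt_universal below proves the corresponding universal property. *)

Inductive expr (K : Type) : Type :=
| EGen of bool
| EStar of bool
| EZero
| EOne
| EOpp of expr K
| EAdd of expr K & expr K
| EMul of expr K & expr K
| EScale of K & expr K.

Arguments EGen {K}.
Arguments EStar {K}.
Arguments EZero {K}.
Arguments EOne {K}.

Inductive congr_expr (K : fieldType) : expr K -> expr K -> Prop :=
| Crefl s : congr_expr s s
| Csym s t of congr_expr s t : congr_expr t s
| Ctrans s t u of congr_expr s t & congr_expr t u : congr_expr s u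
| Copp s s' of congr_expr s s' : congr_expr (EOpp s) (EOpp s')
| Cadd s s' t t' of congr_expr s s' & congr_expr t t' :
    congr_expr (EAdd s t) (EAdd s' t')
| Cmul s s' t t' of congr_expr s s' & congr_expr t t' :
    congr_expr (EMul s t) (EMul s' t')
| Cscale k s s' of congr_expr s s' : congr_expr (EScale k s) (EScale k s')
| CaddA s t u : congr_expr (EAdd s (EAdd t u)) (EAdd (EAdd s t) u)
| CaddC s t : congr_expr (EAdd s t) (EAdd t s)
| Cadd0 s : congr_expr (EAdd EZero s) s
| CaddN s : congr_expr (EAdd (EOpp s) s) EZero
| CmulA s t u : congr_expr (EMul s (EMul t u)) (EMul (EMul s t) u)
| Cmul1l s : congr_expr (EMul EOne s) s
| Cmul1r s : congr_expr (EMul s EOne) s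
| CmulDl s t u : congr_expr (EMul (EAdd s t) u) (EAdd (EMul s u) (EMul t u))
| CmulDr s t u : congr_expr (EMul s (EAdd t u)) (EAdd (EMul s t) (EMul s u))
| CscaleA k l s : congr_expr (EScale k (EScale l s)) (EScale (k * l) s)
| Cscale1 s : congr_expr (EScale 1 s) s
| CscaleDr k s t : congr_expr (EScale k (EAdd s t)) (EAdd (EScale k s) (EScale k t))
| CscaleDl k l s : congr_expr (EScale (k + l) s) (EAdd (EScale k s) (EScale l s))
| CscaleAl k s t : congr_expr (EScale k (EMul s t)) (EMul (EScale k s) t)
| CscaleAr k s t : congr_expr (EScale k (EMul s t)) (EMul s (EScale k t))
| Cee : congr_expr (EMul (EStar false) (EGen false)) EOne
| Cff : congr_expr (EMul (EStar true) (EGen true)) EOne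
| Cef : congr_expr (EMul (EStar false) (EGen true)) EZero
| Cfe : congr_expr (EMul (EStar true) (EGen false)) EZero
| Csum : congr_expr (EAdd (EMul (EGen false) (EStar false))
                         (EMul (EGen true) (EStar true))) EOne.

Section Leavitt.

Variable K : fieldType.

HB.instance Definition _ := gen_eqMixin (expr K).
HB.instance Definition _ := gen_choiceMixin (expr K).

Definition expr_eqv (s t : expr K) : bool := `[< congr_expr s t >].

Lemma expr_eqv_refl : reflexive expr_eqv.
Proof. by move=> s; apply/asboolP; exact: Crefl. Qed.

Lemma expr_eqv_sym : symmetric expr_eqv.
Proof. by move=> s t; apply/asboolP/asboolP; exact: Csym. Qed.

Lemma expr_eqv_trans : transitive expr_eqv.
Proof.
by move=> t s u /asboolP st /asboolP tu; apply/asboolP; exact: Ctrans st tu.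
Qed.

Canonical expr_equiv :=
  EquivRel expr_eqv expr_eqv_refl expr_eqv_sym expr_eqv_trans.

Local Open Scope quotient_scope.

Definition leavitt : Type := {eq_quot expr_equiv}.

HB.instance Definition _ := Choice.on leavitt.
HB.instance Definition _ := EqQuotient.on leavitt.

Definition cls (s : expr K) : leavitt := \pi_leavitt s.

Lemma clsP (s t : expr K) : cls s = cls t <-> congr_expr s t.
Proof.
split=> [/eqP|st].
  by rewrite /cls eqmodE => /asboolP.
by apply/eqP; rewrite /cls eqmodE; apply/asboolP.
Qed.

Lemma clsW (P : leavitt -> Prop) : (forall s, P (cls s)) -> forall x, P x.
Proof. by move=> Pcls x; rewrite -[x]reprK; exact: Pcls. Qed.

Lemma repr_cls (s : expr K) : congr_expr (repr (cls s)) s.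
Proof. by apply/clsP; rewrite /cls reprK. Qed.

Definition leavitt_opp (x : leavitt) := cls (EOpp (repr x)).
Definition leavitt_add (x y : leavitt) := cls (EAdd (repr x) (repr y)).
Definition leavitt_mul (x y : leavitt) := cls (EMul (repr x) (repr y)).
Definition leavitt_scale (k : K) (x : leavitt) := cls (EScale k (repr x)).

Lemma cls_opp s : leavitt_opp (cls s) = cls (EOpp s).
Proof. by apply/clsP/Copp/repr_cls. Qed.

Lemma cls_add s t : leavitt_add (cls s) (cls t) = cls (EAdd s t).
Proof. by apply/clsP/Cadd; exact: repr_cls. Qed.

Lemma cls_mul s t : leavitt_mul (cls s) (cls t) = cls (EMul s t).
Proof. by apply/clsP/Cmul; exact: repr_cls. Qed.

Lemma cls_scale k s : leavitt_scale k (cls s) = cls (EScale k s).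
Proof. by apply/clsP/Cscale/repr_cls. Qed.

Lemma leavitt_addA : associative leavitt_add.
Proof.
by do 3![elim/clsW=> ?]; rewrite !cls_add; apply/clsP; exact: CaddA.
Qed.

Lemma leavitt_addC : commutative leavitt_add.
Proof. by do 2![elim/clsW=> ?]; rewrite !cls_add; apply/clsP; exact: CaddC. Qed.

Lemma leavitt_add0 : left_id (cls EZero) leavitt_add.
Proof. by elim/clsW=> ?; rewrite !cls_add; apply/clsP; exact: Cadd0. Qed.

Lemma leavitt_addN : left_inverse (cls EZero) leavitt_opp leavitt_add.
Proof. by elim/clsW=> ?; rewrite cls_opp !cls_add; apply/clsP; exact: CaddN. Qed.

HB.instance Definition _ := GRing.isZmodule.Build leavitt
  leavitt_addA leavitt_addC leavitt_add0 leavitt_addN.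

Lemma leavitt_mulA : associative leavitt_mul.
Proof.
by do 3![elim/clsW=> ?]; rewrite !cls_mul; apply/clsP; exact: CmulA.
Qed.

Lemma leavitt_mul1l : left_id (cls EOne) leavitt_mul.
Proof. by elim/clsW=> ?; rewrite !cls_mul; apply/clsP; exact: Cmul1l. Qed.

Lemma leavitt_mul1r : right_id (cls EOne) leavitt_mul.
Proof. by elim/clsW=> ?; rewrite !cls_mul; apply/clsP; exact: Cmul1r. Qed.

Lemma leavitt_mulDl : left_distributive leavitt_mul leavitt_add.
Proof.
by do 3![elim/clsW=> ?]; rewrite !(cls_add, cls_mul); apply/clsP; exact: CmulDl.
Qed.

Lemma leavitt_mulDr : right_distributive leavitt_mul leavitt_add.
Proof.
by do 3![elim/clsW=> ?]; rewrite !(cls_add, cls_mul); apply/clsP; exact: CmulDr.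
Qed.

(* Nontriviality: the algebra acts on sequences of scalars, e^* and f^*
   extracting the even and the odd subsequence. *)
Fixpoint expr_act (s : expr K) (v : nat -> K) : nat -> K :=
  match s with
  | EGen b => fun m => if odd m == b then v m./2 else 0
  | EStar b => fun m => v (b + m.*2)%N
  | EZero => fun=> 0
  | EOne => v
  | EOpp s => fun m => - expr_act s v m
  | EAdd s t => fun m => expr_act s v m + expr_act t v m
  | EMul s t => expr_act s (expr_act t v)
  | EScale k s => fun m => k * expr_act s v m
  end.

Lemma expr_actD s v w :
  expr_act s (fun m => v m + w m) = fun m => expr_act s v m + expr_act s w m.
Proof.
elim: s v w => [b|b|||s IHs|s IHs t IHt|s IHs t IHt|k s IHs] v w //=;
  apply/funext => m; rewrite ?IHt ?IHs ?addr0 ?opprD ?mulrDr //.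
- by case: ifP; rewrite ?addr0.
- by rewrite addrACA.
Qed.

Lemma expr_actZ s k v : expr_act s (fun m => k * v m) = fun m => k * expr_act s v m.
Proof.
elim: s v => [b|b|||s IHs|s IHs t IHt|s IHs t IHt|l s IHs] v //=;
  apply/funext => m; rewrite ?IHt ?IHs ?mulr0 ?mulrN ?mulrDr //.
- by case: ifP; rewrite ?mulr0.
- by rewrite mulrCA.
Qed.

Lemma expr_act_congr s t : congr_expr s t -> expr_act s = expr_act t.
Proof.
move=> st; apply/funext; elim: st => {s t} //=.
- by move=> s t _ IH v; rewrite IH.
- by move=> s t u _ IHst _ IHtu v; rewrite IHst.
- by move=> s s' _ IH v; rewrite IH.
- by move=> s s' t t' _ IHs _ IHt v; rewrite IHs IHt.
- by move=> s s' t t' _ IHs _ IHt v; rewrite IHs IHt.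
- by move=> k s s' _ IH v; rewrite IH.
- by move=> s t u v; apply/funext => m; rewrite addrA.
- by move=> s t v; apply/funext => m; rewrite addrC.
- by move=> s v; apply/funext => m; rewrite add0r.
- by move=> s v; apply/funext => m; rewrite addNr.
- by move=> s t u v; rewrite expr_actD.
- by move=> k l s v; apply/funext => m; rewrite mulrA.
- by move=> s v; apply/funext => m; rewrite mul1r.
- by move=> k s t v; apply/funext => m; rewrite mulrDr.
- by move=> k l s v; apply/funext => m; rewrite mulrDl.
- by move=> k s t v; rewrite expr_actZ.
- by move=> v; apply/funext => m; rewrite add0n odd_double doubleK.
- by move=> v; apply/funext => m; rewrite /= odd_double uphalf_double.
- by move=> v; apply/funext => m; rewrite add0n odd_double.
- by move=> v; apply/funext => m; rewrite /= odd_double.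
- move=> v; apply/funext => m; case: (boolP (odd m)) => om /=.
    by rewrite add0r -[in RHS](odd_double_half m) om.
  by rewrite addr0 -[in RHS](odd_double_half m) (negbTE om).
Qed.

Lemma leavitt_one_neq0 : cls EOne != cls EZero.
Proof.
apply/eqP => /clsP/expr_act_congr/(congr1 (fun h => h (fun=> 1) 0%N)) /=.
by move/eqP; rewrite oner_eq0.
Qed.

HB.instance Definition _ := GRing.Zmodule_isNzRing.Build leavitt
  leavitt_mulA leavitt_mul1l leavitt_mul1r leavitt_mulDl leavitt_mulDr
  leavitt_one_neq0.

Lemma leavitt_scaleA (k l : K) (x : leavitt) :
  leavitt_scale k (leavitt_scale l x) = leavitt_scale (k * l) x.
Proof. by elim/clsW: x => ?; rewrite !cls_scale; apply/clsP; exact: CscaleA. Qed.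

Lemma leavitt_scale1 : left_id 1 leavitt_scale.
Proof. by elim/clsW=> ?; rewrite !cls_scale; apply/clsP; exact: Cscale1. Qed.

Lemma leavitt_scaleDr : right_distributive leavitt_scale +%R.
Proof.
move=> k; do 2![elim/clsW=> ?].
by rewrite /GRing.add /= !(cls_add, cls_scale); apply/clsP; exact: CscaleDr.
Qed.

Lemma leavitt_scaleDl (x : leavitt) : {morph leavitt_scale^~ x : k l / k + l}.
Proof.
move=> k l; elim/clsW: x => ?.
rewrite [in RHS]/GRing.add /= !(cls_add, cls_scale); apply/clsP; exact: CscaleDl.
Qed.

HB.instance Definition _ := GRing.Zmodule_isLmodule.Build K leavitt
  leavitt_scaleA leavitt_scale1 leavitt_scaleDr leavitt_scaleDl.

Lemma leavitt_scaleAl (k : K) (x y : leavitt) : k *: (x * y) = k *: x * y.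
Proof.
elim/clsW: x => ?; elim/clsW: y => ?.
rewrite /GRing.scale /GRing.mul /= !(cls_mul, cls_scale); apply/clsP.
exact: CscaleAl.
Qed.

HB.instance Definition _ := GRing.Lmodule_isLalgebra.Build K leavitt
  leavitt_scaleAl.

Lemma leavitt_scaleAr (k : K) (x y : leavitt) : k *: (x * y) = x * (k *: y).
Proof.
elim/clsW: x => ?; elim/clsW: y => ?.
rewrite /GRing.scale /GRing.mul /= !(cls_mul, cls_scale); apply/clsP.
exact: CscaleAr.
Qed.

HB.instance Definition _ := GRing.Lalgebra_isAlgebra.Build K leavitt
  leavitt_scaleAr.

Definition leavitt_unit : pred leavitt :=
  fun x => `[< exists y, y * x = 1 /\ x * y = 1 >].

Definition leavitt_inv (x : leavitt) : leavitt :=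
  if pselect (exists y, y * x = 1 /\ x * y = 1) is left h
  then projT1 (cid h) else x.

Lemma leavitt_mulVr : {in leavitt_unit, left_inverse 1 leavitt_inv *%R}.
Proof.
move=> x /asboolP xu; rewrite /leavitt_inv; case: pselect => // h.
by case: cid => y [].
Qed.

Lemma leavitt_mulrV : {in leavitt_unit, right_inverse 1 leavitt_inv *%R}.
Proof.
move=> x /asboolP xu; rewrite /leavitt_inv; case: pselect => // h.
by case: cid => y [].
Qed.

Lemma leavitt_unitP (x y : leavitt) : y * x = 1 /\ x * y = 1 -> leavitt_unit x.
Proof. by move=> xy; apply/asboolP; exists y. Qed.

Lemma leavitt_inv_out : {in [predC leavitt_unit], leavitt_inv =1 id}.
Proof.
by move=> x /asboolPn nux; rewrite /leavitt_inv; case: pselect => // h.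
Qed.

HB.instance Definition _ := GRing.NzRing_hasMulInverse.Build leavitt
  leavitt_mulVr leavitt_mulrV leavitt_unitP leavitt_inv_out.

Definition lgen (b : bool) : leavitt := cls (EGen b).
Definition lstar (b : bool) : leavitt := cls (EStar b).

(* The star reverses words: (x_1 ... x_r)^* is x_r^* ... x_1^*. *)
Definition lword (g : word) : leavitt := \prod_(x <- g) lgen x.
Definition lword_star (g : word) : leavitt := \prod_(x <- rev g) lstar x.

Definition Theta n (C : n.-tuple word) (A : 'M[leavitt]_n) : leavitt :=
  \sum_(i < n) \sum_(j < n)
    lword (tnth C i) * A i j * lword_star (tnth C j).

End Leavitt.

Definition leavitt_family (K : fieldType) (A : algType K) (g s : bool -> A) :
    Prop :=
  [/\ s false * g false = 1 /\ s true * g true = 1,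
      s false * g true = 0 /\ s true * g false = 0
    & g false * s false + g true * s true = 1].

Lemma leavitt_relations (K : fieldType) :
  leavitt_family (A := leavitt K) (@lgen K) (@lstar K).
Proof.
split; [split|split|]; rewrite /GRing.add /GRing.mul /= !cls_mul ?cls_add;
  apply/clsP; [exact: Cee|exact: Cff|exact: Cef|exact: Cfe|exact: Csum].
Qed.

Section Universal.

Variables (K : fieldType) (A : algType K) (g s : bool -> A).
Hypothesis gsP : leavitt_family g s.

Fixpoint expr_eval (t : expr K) : A :=
  match t with
  | EGen b => g b
  | EStar b => s b
  | EZero => 0
  | EOne => 1
  | EOpp t => - expr_eval t
  | EAdd t u => expr_eval t + expr_eval u
  | EMul t u => expr_eval t * expr_eval u
  | EScale k t => k *: expr_eval t
  end.

Lemma expr_eval_congr t u : congr_expr t u -> expr_eval t = expr_eval u.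
Proof.
case: gsP => -[r1 r2] [r3 r4] r5; elim=> //=.
- by move=> ? ? ? _ -> _ ->.
- by move=> ? ? _ ->.
- by move=> ? ? ? ? _ -> _ ->.
- by move=> ? ? ? ? _ -> _ ->.
- by move=> ? ? ? _ ->.
- by move=> *; rewrite addrA.
- by move=> *; rewrite addrC.
- by move=> *; rewrite add0r.
- by move=> *; rewrite addNr.
- by move=> *; rewrite mulrA.
- by move=> *; rewrite mul1r.
- by move=> *; rewrite mulr1.
- by move=> *; rewrite mulrDl.
- by move=> *; rewrite mulrDr.
- by move=> *; rewrite scalerA.
- by move=> *; rewrite scale1r.
- by move=> *; rewrite scalerDr.
- by move=> *; rewrite scalerDl.
- by move=> *; rewrite scalerAl.
- by move=> *; rewrite scalerAr.
Qed.

Definition leavitt_lift (x : leavitt K) : A := expr_eval (repr x).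

Lemma leavitt_liftE t : leavitt_lift (cls t) = expr_eval t.
Proof. exact/expr_eval_congr/repr_cls. Qed.

Lemma leavitt_lift_linear : linear leavitt_lift.
Proof.
move=> k x y; elim/clsW: x => t; elim/clsW: y => u.
rewrite [k *: cls t]/GRing.scale /= cls_scale [cls _ + _]/GRing.add /= cls_add.
by rewrite !leavitt_liftE.
Qed.

Lemma leavitt_lift_monoid : monoid_morphism leavitt_lift.
Proof.
split=> [|x y]; first by rewrite /GRing.one /= leavitt_liftE.
elim/clsW: x => t; elim/clsW: y => u.
by rewrite [cls _ * _]/GRing.mul /= cls_mul !leavitt_liftE.
Qed.

HB.instance Definition _ :=
  GRing.isLinear.Build K (leavitt K) A *:%R leavitt_lift leavitt_lift_linear.
HB.instance Definition _ :=
  GRing.isMonoidMorphism.Build (leavitt K) A leavitt_lift leavitt_lift_monoid.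

Lemma leavitt_universal :
  exists2 phi : {lrmorphism leavitt K -> A},
    (forall b, phi (lgen K b) = g b /\ phi (lstar K b) = s b)
  & forall psi : {lrmorphism leavitt K -> A},
      (forall b, psi (lgen K b) = g b /\ psi (lstar K b) = s b) -> psi =1 phi.
Proof.
exists leavitt_lift => [b|psi psiP x].
  by rewrite /= /lgen /lstar !leavitt_liftE.
elim/clsW: x => t; rewrite /= leavitt_liftE.
elim: t => [b|b|||t IHt|t IHt u IHu|t IHt u IHu|k t IHt] /=.
- by case: (psiP b).
- by case: (psiP b).
- by rewrite -[cls EZero]/(0 : leavitt K) raddf0.
- by rewrite -[cls EOne]/(1 : leavitt K) rmorph1.
- by rewrite -IHt -cls_opp -[leavitt_opp _]/(- cls t) raddfN.
- by rewrite -IHt -IHu -cls_add -[leavitt_add _ _]/(cls t + cls u) raddfD.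
- by rewrite -IHt -IHu -cls_mul -[leavitt_mul _ _]/(cls t * cls u) rmorphM.
- by rewrite -IHt -cls_scale -[leavitt_scale _ _]/(k *: cls t) linearZ.
Qed.

End Universal.

(* Main.v *)
Require Import Defs.
From mathcomp Require Import all_boot all_order all_algebra.
From mathcomp Require Import finmap.
From mathcomp Require Import boolp classical_sets.
Import GRing.Theory.
Local Open Scope classical_set_scope.
Local Open Scope ring_scope.

Set Implicit Arguments.
Unset Strict Implicit.
Unset Printing Implicit Defensive.

(* Write diag(y) = e y e^* + f f^* and let G be the group generated by the
   1 + e a f^* and 1 + f b e^*.  Since L is purely infinite, every unit is
   k diag(v) h with k, h in G and v a unit; with Whitehead's lemma this makes G
   normal in L^x with abelian quotient, and it remains to see that diag(y) lies
   in G for every unit y.  Modulo G, the class of diag(y) does not change when y,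
   read as a rectangular matrix L^m -> L^n through leaf sets, is multiplied by
   elementary or constant matrices, is enlarged by a 1 on the diagonal, or has
   one of its rows or columns split along a leaf.  Splitting columns makes all
   entries polynomials in e and f, and Higman's trick makes them linear.  An
   invertible pencil T0 + e T1 + f T2 over K shrinks until nothing is left: if
   T0 has dependent rows one splits a row into constant rows, otherwise the
   inverse is a polynomial matrix and T1, T2 have a common kernel vector.
   For any other leaf set, e a f^* is a sum of terms g_i x g_j^* with i <> j
   whose pairwise products vanish, so 1 + e a f^* is in the image of E_n(L). *)

(** * Two by two matrices and elementary units *)

Section LeavittUnits.

Variables (K : fieldType) (L : unitAlgType K) (g s : bool -> L).
Hypothesis gsP : leavitt_family g s.

Local Notation e := (g false).
Local Notation f := (g true).
Local Notation e' := (s false).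
Local Notation f' := (s true).

Let e'e : e' * e = 1. Proof. by case: gsP => -[]. Qed.
Let f'f : f' * f = 1. Proof. by case: gsP => -[]. Qed.
Let e'f : e' * f = 0. Proof. by case: gsP => _ []. Qed.
Let f'e : f' * e = 0. Proof. by case: gsP => _ []. Qed.
Let ee'ff' : e * e' + f * f' = 1. Proof. by case: gsP. Qed.

Lemma mulKs b x : s b * (g b * x) = x.
Proof. by case: b; rewrite mulrA ?f'f ?e'e mul1r. Qed.

Lemma mul0s b x : s b * (g (~~ b) * x) = 0.
Proof. by case: b; rewrite mulrA ?f'e ?e'f mul0r. Qed.

(* The matrix with rows (a, b) and (c, d), under M_2(L) = L. *)
Definition mx2 a b c d : L := e * (a * e' + b * f') + f * (c * e' + d * f').

Lemma mul_e'_mx2 a b c d : e' * mx2 a b c d = a * e' + b * f'.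
Proof. by rewrite /mx2 mulrDr (mulKs false) (mul0s false) addr0. Qed.

Lemma mul_f'_mx2 a b c d : f' * mx2 a b c d = c * e' + d * f'.
Proof. by rewrite /mx2 mulrDr (mulKs true) (mul0s true) add0r. Qed.

Lemma mx2_entries x :
  x = mx2 (e' * x * e) (e' * x * f) (f' * x * e) (f' * x * f).
Proof.
rewrite /mx2 -!(mulrA _ e e') -!(mulrA _ f f') -!mulrDr ee'ff' !mulr1 !mulrA.
by rewrite -mulrDl ee'ff' mul1r.
Qed.

Lemma mx2M a b c d x y z t :
  mx2 a b c d * mx2 x y z t =
  mx2 (a * x + b * z) (a * y + b * t) (c * x + d * z) (c * y + d * t).
Proof.
rewrite {1}/mx2 mulrDl -!mulrA !mulrDl -!mulrA mul_e'_mx2 mul_f'_mx2 /mx2.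
by rewrite !mulrDr !mulrDl !mulrDr !mulrA; congr (_ + _); rewrite addrACA.
Qed.

Lemma mx2_1 : mx2 1 0 0 1 = 1.
Proof. by rewrite /mx2 !mul1r !mul0r addr0 add0r. Qed.

Lemma mx2_upper b : mx2 1 b 0 1 = 1 + e * b * f'.
Proof. by rewrite /mx2 !mul1r !mul0r add0r mulrDr -ee'ff' addrAC mulrA. Qed.

Lemma mx2_lower c : mx2 1 0 c 1 = 1 + f * c * e'.
Proof.
by rewrite /mx2 !mul1r !mul0r addr0 mulrDr -ee'ff' -addrA [X in _ + X]addrC
  mulrA.
Qed.

Let simp2 :=
  (@mulr1 L, @mul1r L, @mulr0 L, @mul0r L, @addr0 L, @add0r L, @mulrN L,
   @mulNr L, @opprK L, @oppr0 L, @subrr L, @addNr L).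

Definition elemL : set L :=
  generated_subgroup
    ([set 1 + e * a * f' | a in [set: L]] `|`
     [set 1 + f * b * e' | b in [set: L]]).

Lemma elemL1 : elemL 1. Proof. exact: gen_one. Qed.

Lemma elemLM x y : elemL x -> elemL y -> elemL (x * y).
Proof. exact: gen_mul. Qed.

Lemma elemLI x y : elemL x -> x * y = 1 -> y * x = 1 -> elemL y.
Proof. exact: gen_inv. Qed.

Lemma elemL_upper b : elemL (mx2 1 b 0 1).
Proof. by rewrite mx2_upper; apply: gen_incl; left; exists b. Qed.

Lemma elemL_lower c : elemL (mx2 1 0 c 1).
Proof. by rewrite mx2_lower; apply: gen_incl; right; exists c. Qed.

Lemma elemL_unit x : elemL x -> x \is a GRing.unit.
Proof.
elim=> {x} [|x [] [a _ <-]|x y _ ux _ uy|x y _ ux xy yx]; rewrite ?unitr1 //.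
- rewrite -mx2_upper; apply/unitrP; exists (mx2 1 (- a) 0 1).
  by rewrite !mx2M !simp2 mx2_1.
- rewrite -mx2_lower; apply/unitrP; exists (mx2 1 0 (- a) 1).
  by rewrite !mx2M !simp2 mx2_1.
- by rewrite unitrMl.
- by apply/unitrP; exists x.
Qed.

Lemma elemLV x : elemL x -> elemL x^-1.
Proof. by move=> Gx; apply: (elemLI Gx); rewrite ?mulrV ?mulVr ?elemL_unit. Qed.

Lemma elemL_mulr x y : elemL x -> elemL (x * y) -> elemL y.
Proof.
move=> Gx Gxy; rewrite -[y]mul1r -(mulVr (elemL_unit Gx)) -mulrA.
exact/elemLM/Gxy/elemLV.
Qed.

Lemma elemL_mull x y : elemL y -> elemL (x * y) -> elemL x.
Proof.
move=> Gy Gxy; rewrite -[x]mulr1 -(mulrV (elemL_unit Gy)) mulrA.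
exact/elemLM/elemLV.
Qed.

(** Under these relations [(1 + X) (1 + Y) = (1 + X Y) (1 + Y) (1 + X)], so [1 + X * Y] is the
    commutator of [1 + X] and [1 + Y]. *)
Lemma elemL_comm X Y : X * X = 0 -> Y * Y = 0 -> Y * X = 0 ->
  elemL (1 + X) -> elemL (1 + Y) -> elemL (1 + X * Y).
Proof.
move=> XX YY YX GX GY; apply: (@elemL_mull _ ((1 + Y) * (1 + X))).
  exact: elemLM.
suff -> : (1 + X * Y) * ((1 + Y) * (1 + X)) = (1 + X) * (1 + Y) by exact:
  elemLM.
have -> : (1 + Y) * (1 + X) = 1 + (X + Y).
  by rewrite mulrDl mul1r mulrDr mulr1 YX addr0 addrA.
have XYZ : X * Y * (X + Y) = 0.
  by rewrite mulrDr -!mulrA YX YY !mulr0 addr0.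
rewrite mulrDl mul1r mulrDr mulr1 XYZ addr0.
by rewrite mulrDl mul1r mulrDr mulr1 !addrA [1 + X + Y]addrAC.
Qed.

Definition diag y := mx2 y 0 0 1.

Lemma diagE y : diag y = e * y * e' + f * f'.
Proof. by rewrite /diag /mx2 !mul0r mul1r addr0 add0r mulrA. Qed.

Lemma diag1 : diag 1 = 1. Proof. exact: mx2_1. Qed.

Lemma diagM x y : diag x * diag y = diag (x * y).
Proof. by rewrite /diag mx2M !simp2. Qed.

Lemma mx2_inj a b c d x y z t :
  mx2 a b c d = mx2 x y z t -> [/\ a = x, b = y, c = z & d = t].
Proof.
have E p q : (p * e' + q * f') * e = p.
  by rewrite mulrDl -!mulrA e'e f'e !simp2.
have F p q : (p * e' + q * f') * f = q.
  by rewrite mulrDl -!mulrA e'f f'f !simp2.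
move=> abcd; have top := congr1 (fun u => e' * u) abcd.
have bot := congr1 (fun u => f' * u) abcd.
rewrite /= !mul_e'_mx2 in top; rewrite /= !mul_f'_mx2 in bot.
split; [rewrite -(E a b) top E | rewrite -(F a b) top F
       | rewrite -(E c d) bot E | rewrite -(F c d) bot F]; by [].
Qed.

Lemma diag_unit y : (diag y \is a GRing.unit) = (y \is a GRing.unit).
Proof.
apply/unitrP/unitrP => -[z [zy yz]]; last first.
  by exists (diag z); rewrite !diagM zy yz diag1.
exists (e' * z * e); have zE := mx2_entries z.
rewrite zE /diag mx2M -[RHS]mx2_1 !simp2 in zy.
rewrite zE /diag mx2M -[RHS]mx2_1 !simp2 in yz.
by case/mx2_inj: zy => -> _ _ _; case/mx2_inj: yz => -> _ _ _.
Qed.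

(** Conjugating by [diag y] only rescales the parameter of a transvection: [a] becomes [y * a] and
    [b] becomes [b * y^-1]. *)
Lemma elemL_diag_conj y x : y \is a GRing.unit ->
  elemL x -> elemL (diag y * x * diag y^-1).
Proof.
move=> uy; elim=> {x} [|x [] [a _ <-]|x z _ Gx _ Gz|x z _ Gx xz zx].
- by rewrite mulr1 diagM mulrV // diag1; exact: elemL1.
- by rewrite -mx2_upper !mx2M !simp2 mulrV //; exact: elemL_upper.
- by rewrite -mx2_lower !mx2M !simp2 mulrV //; exact: elemL_lower.
- suff -> : diag y * (x * z) * diag y^-1 =
    (diag y * x * diag y^-1) * (diag y * z * diag y^-1) by exact: elemLM.
  by rewrite -!mulrA (mulrA (diag _^-1) (diag y)) diagM mulVr // diag1 mul1r.
- have VD p q : diag y * p * diag y^-1 * (diag y * q * diag y^-1) =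
                diag y * (p * q) * diag y^-1.
    by rewrite -!mulrA (mulrA (diag _^-1) (diag y)) diagM mulVr // diag1 mul1r.
  apply: (elemLI Gx); rewrite VD ?xz ?zx mulr1 diagM mulrV //; exact: diag1.
Qed.

Lemma elemL_weyl y : y \is a GRing.unit -> elemL (mx2 0 y (- y^-1) 0).
Proof.
move=> uy; suff -> : mx2 0 y (- y^-1) 0 =
    mx2 1 y 0 1 * mx2 1 0 (- y^-1) 1 * mx2 1 y 0 1.
  by apply: elemLM (elemL_upper _); exact: elemLM (elemL_upper _) (elemL_lower
    _).
by rewrite !mx2M !simp2 mulrV // mulVr // !simp2.
Qed.

Lemma elemL_whitehead y : y \is a GRing.unit -> elemL (mx2 y 0 0 y^-1).
Proof.
move=> uy; suff -> : mx2 y 0 0 y^-1 = mx2 0 y (- y^-1) 0 * mx2 0 (-1) (-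
  (-1)^-1) 0.
  by apply: elemLM; apply: elemL_weyl; rewrite ?unitrN1.
by rewrite mx2M invrN invr1 !simp2.
Qed.

(** Three Whitehead matrices, for [x], [y] and [(y * x)^-1], are multiplied; their lower entries
    cancel because [x^-1 y^-1 (y x) = 1]. *)
Lemma elemL_diag_commutator x y : x \is a GRing.unit -> y \is a GRing.unit ->
  elemL (diag (x * y * (y * x)^-1)).
Proof.
move=> ux uy; have uyx : y * x \is a GRing.unit by rewrite unitrMl.
suff -> : diag (x * y * (y * x)^-1) =
    mx2 x 0 0 x^-1 * mx2 y 0 0 y^-1 * mx2 (y * x)^-1 0 0 (y * x)^-1^-1.
  by apply: elemLM; [apply: elemLM|]; apply: elemL_whitehead; rewrite ?unitrV.
rewrite !mx2M !simp2 invrK /diag; congr mx2.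
by rewrite -!mulrA (mulrA _ y x) mulVr // mul1r mulVr.
Qed.

(** Apply [elemL_comm] to [e a f'] and [f b e']: their product is [e a b e'], and the reverse
    product vanishes with [b * a]. *)
Lemma elemL_diag_nilp a b : b * a = 0 -> elemL (diag (1 + a * b)).
Proof.
move=> ba; have -> : diag (1 + a * b) = 1 + (e * a * f') * (f * b * e').
  rewrite diagE mulrDr mulrDl mulr1 addrAC ee'ff' !mulrA.
  by rewrite -(mulrA _ f') f'f mulr1.
apply: elemL_comm; rewrite -?mx2_upper -?mx2_lower.
- by rewrite -!mulrA (mulrA f') f'e mul0r !mulr0.
- by rewrite -!mulrA (mulrA e') e'f mul0r !mulr0.
- by rewrite -!mulrA (mulrA e' e) e'e mul1r (mulrA b) ba mul0r mulr0.
- exact: elemL_upper.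
- exact: elemL_lower.
Qed.

(** * Shears along words *)

Lemma elemL_transv b a : elemL (1 + g b * a * s (~~ b)).
Proof.
case: b; [rewrite -mx2_lower; exact: elemL_lower|].
by rewrite -mx2_upper; exact: elemL_upper.
Qed.

Lemma elemL_transvN b a : elemL (1 + g (~~ b) * a * s b).
Proof. by have := elemL_transv (~~ b) a; rewrite negbK. Qed.

Lemma mul0sN b x : s (~~ b) * (g b * x) = 0.
Proof. by have := mul0s (~~ b) x; rewrite negbK. Qed.

Lemma mulgs b : g b * s b = 1 - g (~~ b) * s (~~ b).
Proof. by case: b => /=; rewrite -ee'ff' ?addrK // addrC addKr. Qed.

Lemma split_gs b x : x = g b * (s b * x) + g (~~ b) * (s (~~ b) * x).
Proof. by rewrite !mulrA -mulrDl mulgs subrK mul1r. Qed.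

Lemma split_sg b x : x = x * g b * s b + x * g (~~ b) * s (~~ b).
Proof. by rewrite -!mulrA -mulrDr mulgs subrK mulr1. Qed.

Lemma elemL_nilp b x y : y * x = 0 -> elemL (1 + g b * (x * y) * s b).
Proof.
move=> yx; have -> : g b * (x * y) * s b =
    (g b * x * s (~~ b)) * (g (~~ b) * y * s b).
  by rewrite -!mulrA mulKs.
apply: elemL_comm.
- by rewrite -!mulrA mul0sN !mulr0.
- by rewrite -!mulrA mul0s !mulr0.
- by rewrite -!mulrA mulKs (mulrA y) yx mul0r mulr0.
- exact: elemL_transv.
- exact: elemL_transvN.
Qed.

(** Splitting [a] by columns leaves a corner term, covered by [elemL_nilp], and an ordinary
    transvection. *)
Lemma elemL_nilp_word b d a : a * (g b * d) = 0 -> elemL (1 + g b * d * a).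
Proof.
move=> ad; have -> : 1 + g b * d * a =
    (1 + g b * (d * (a * g b)) * s b) * (1 + g b * (d * a * g (~~ b)) * s (~~
      b)).
  set P := _ * s b; set Q := _ * s (~~ b).
  have PQ : P * Q = 0.
    suff -> : P * Q = g b * d * (a * (g b * d)) * (a * g (~~ b) * s (~~ b)).
      by rewrite ad mulr0 mul0r.
    by rewrite /P /Q -!mulrA mulKs.
  rewrite mulrDl mul1r mulrDr mulr1 PQ addr0 -addrA; congr (_ + _).
  by rewrite [in LHS](split_sg b a) addrC mulrDr /P /Q !mulrA addrC.
apply: elemLM (elemL_transv _ _); apply: elemL_nilp.
by rewrite -mulrA.
Qed.

Lemma elemL_nilp_word_star b d a : d * s b * a = 0 -> elemL (1 + a * (d * s b)).
Proof.
move=> da; have -> : 1 + a * (d * s b) =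
    (1 + g (~~ b) * (s (~~ b) * a * d) * s b) * (1 + g b * (s b * a * d) * s b).
  set P := g (~~ b) * _ * s b; set Q := g b * _ * s b.
  have PQ : P * Q = 0.
    suff -> : P * Q = g (~~ b) * s (~~ b) * a * (d * s b * a) * (d * s b).
      by rewrite da mulr0 mul0r.
    by rewrite /P /Q -!mulrA mulKs.
  rewrite mulrDl mul1r mulrDr mulr1 PQ addr0 -addrA; congr (_ + _).
  by rewrite [in LHS](split_gs b a) mulrDl /P /Q !mulrA.
apply: elemLM; first exact: elemL_transvN.
by apply: elemL_nilp; rewrite mulrA.
Qed.

Lemma elemL_move_word b d d' : d' * d = 1 ->
  exists2 k, elemL k & k * (g b * d) = g (~~ b).
Proof.
move=> d'd; exists ((1 - g b * d * s (~~ b)) * (1 + g (~~ b) * d' * s b)).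
  apply: elemLM; last exact: elemL_transvN.
  by rewrite -mulNr -mulrN; exact: elemL_transv.
have sg : s (~~ b) * g (~~ b) = 1 by have := mulKs (~~ b) 1; rewrite !mulr1.
rewrite -[_ * (g b * d)]mulrA [_ * (g b * d)]mulrDl mul1r -!mulrA mulKs d'd
  mulr1.
by rewrite mulrBl mul1r mulrDr -!mulrA mul0sN sg mulr1 !mulr0 add0r addrC addKr.
Qed.

(** * Polynomials in e and f *)

(* Polynomials of degree at most D in e and f, in Horner form. *)
Fixpoint hpol D (p : L) : Prop :=
  if D is D'.+1 then
    exists c p1 p2, [/\ hpol D' p1, hpol D' p2 & p = c%:A + e * p1 + f * p2]
  else exists c : K, p = c%:A.

Definition poly p := exists D, hpol D p.

Definition wd (w : seq bool) : L := \prod_(x <- w) g x.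

(* The word e^n f is unbordered, so sandwiching a polynomial of degree at most n
   between its adjoint and itself isolates the constant term. *)
Definition probe n := e ^+ n * f.
Definition probe' n := f' * e' ^+ n.

Lemma probe_wd n : probe n = wd (rcons (nseq n false) true).
Proof.
by rewrite /wd -cats1 big_cat big_seq1 big_nseq -Monoid.iteropE.
Qed.

Lemma probe'S n x : probe' n.+1 * (e * x) = probe' n * x.
Proof. by rewrite /probe' exprSr -!mulrA (mulKs false). Qed.

Lemma probe'f n x : probe' n.+1 * (f * x) = 0.
Proof. by rewrite /probe' exprSr -!mulrA (mul0s false) !mulr0. Qed.

Lemma probe'_probe m n : probe' m * probe n = (m == n)%:R.
Proof.
elim: m n => [|m IH] [|n].
- by rewrite /probe /probe' !expr0 mulr1 mul1r f'f.
- by rewrite /probe /probe' expr0 mulr1 exprS -mulrA (mul0s true).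
- by rewrite /probe expr0 mul1r -[f]mulr1 probe'f.
- by rewrite /probe exprS -mulrA probe'S IH.
Qed.

(** Each Horner level is either killed by the left probe or shortens it, so its exponent stays below
    that of the right probe and every constant met is killed. *)
Lemma hpol_sep0 D m n p : (D <= m < n)%N -> hpol D p -> probe' m * p * probe n
  = 0.
Proof.
elim: D m n p => [|D IH] m n p /andP[Dm mn] /= => [[c ->]|[c [p1 [p2 [h1 h2
  ->]]]]].
  by rewrite -scalerAr mulr1 -scalerAl probe'_probe (ltn_eqF mn) scaler0.
case: m Dm mn => // m Dm; case: n => // n mn.
rewrite !mulrDr !mulrDl probe'S probe'f mul0r addr0 -scalerAr mulr1 -scalerAl
  probe'_probe.
rewrite (ltn_eqF mn) scaler0 add0r.
by apply: IH h1; rewrite -ltnS Dm /= ltnW.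
Qed.

Lemma hpol_const D c p1 p2 : hpol D p1 -> hpol D p2 ->
  probe' D.+1 * (c%:A + e * p1 + f * p2) * probe D.+1 = c%:A.
Proof.
move=> h1 h2; rewrite !mulrDr !mulrDl probe'S probe'f mul0r addr0 -scalerAr
  mulr1.
by rewrite -scalerAl probe'_probe eqxx (@hpol_sep0 D) ?addr0 // leqnn ltnSn.
Qed.

(** Uniqueness of the Horner form: the probe reads off [c], after which [e'] and [f'] read off [p1]
    and [p2]. *)
Lemma hpol_eq0 D c p1 p2 : hpol D p1 -> hpol D p2 ->
  c%:A + e * p1 + f * p2 = 0 -> [/\ c = 0, p1 = 0 & p2 = 0].
Proof.
move=> h1 h2 p0; have := hpol_const c h1 h2; rewrite p0 mulr0 mul0r.
move=> /esym/eqP; rewrite scaler_eq0 oner_eq0 orbF => /eqP c0.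
move: p0; rewrite c0 scale0r add0r => p0; split=> //.
  have := congr1 (fun x => e' * x) p0.
  by rewrite /= mulrDr (mulKs false) (mul0s false) addr0 mulr0.
have := congr1 (fun x => f' * x) p0.
by rewrite /= mulrDr (mulKs true) (mul0s true) add0r mulr0.
Qed.

(** Multiplying by [e'] or [f'] strips letters until the constant term is nonzero; the probe then
    isolates that term, a scalar that can be inverted. *)
Lemma hpol_cancel D p : hpol D p -> p != 0 -> exists a n, a * p * probe n = 1.
Proof.
have scal (c : K) x : c != 0 -> x = c%:A -> c^-1 *: x = 1.
  by move=> c0 ->; rewrite scalerA mulVf ?scale1r.
elim: D p => [|D IH] p /= => [[c ->]|[c [p1 [p2 [h1 h2 pE]]]]].
  rewrite scaler_eq0 oner_eq0 orbF => c0; exists (c^-1 *: probe' 0), 0%N.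
  by rewrite -!scalerAl; apply: scal => //; rewrite -scalerAr mulr1 -scalerAl
    probe'_probe.
have [c0|c0] := eqVneq c 0; last first.
  exists (c^-1 *: probe' D.+1), D.+1; rewrite -!scalerAl; apply: scal => //.
  by rewrite pE hpol_const.
move: pE; rewrite c0 scale0r add0r => pE p0.
have [p10|p10] := eqVneq p1 0.
  have p20 : p2 != 0 by apply: contraNneq p0 => p20; rewrite pE p10 p20 !mulr0
    addr0.
  have [a [n E]] := IH _ h2 p20; exists (a * f'), n.
  by rewrite pE -[a * _ * _]mulrA mulrDr (mulKs true) (mul0s true) add0r.
have [a [n E]] := IH _ h1 p10; exists (a * e'), n.
by rewrite pE -[a * _ * _]mulrA mulrDr (mulKs false) (mul0s false) addr0.
Qed.

(** Long words absorb the starred letters to their left. For the Leavitt algebra this is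
    [leavitt_mul_word_poly]. *)
Hypothesis genP :
  forall y, exists m, forall w : seq bool, (m <= size w)%N -> poly (y * wd w).

(** As [y = y e e' + y f f'], one of [y * e] and [y * f] is nonzero. *)
Lemma mul_wd_neq0 y m : y != 0 -> exists2 w, size w = m & y * wd w != 0.
Proof.
elim: m y => [|m IH] y y0; first by exists [::]; rewrite // /wd big_nil mulr1.
have [b yb] : exists b, y * g b != 0.
  have [ye|] := eqVneq (y * e) 0; last by exists false.
  exists true; apply: contraNneq y0 => yf.
  by rewrite [y](split_sg false) /= ye yf !mul0r addr0.
have [w sw yw] := IH _ yb; exists (b :: w); first by rewrite /= sw.
by rewrite /wd big_cons mulrA.
Qed.

Lemma word_cancel y : y != 0 ->
  exists a b w, a * y * (g b * wd w) = 1.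
Proof.
move=> y0; have [m ym] := genP y.
(* Length [m.+1] rather than [m] makes the word nonempty, which exposes its first letter [b]. *)
have [w sw yw] := mul_wd_neq0 m.+1 y0.
have [|D hD] := ym w; first by rewrite sw.
have [a [n E]] := hpol_cancel hD yw.
case: w sw yw hD E => [|b w] //= _ _ _ E.
exists a, b, (w ++ rcons (nseq n false) true).
by move: E; rewrite probe_wd /wd big_cat big_cons /= !mulrA.
Qed.

Definition wd' (w : seq bool) : L := \prod_(x <- rev w) s x.

Lemma wd'_wd w : wd' w * wd w = 1.
Proof.
elim: w => [|b w IH]; first by rewrite /wd /wd' !big_nil mulr1.
by rewrite /wd /wd' rev_cons -cats1 big_cat big_seq1 big_cons /= -mulrA mulKs.
Qed.

(* Here L is purely infinite: the unit u can be moved by G so that it fixes f. *)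
Lemma unit_diag u : u \is a GRing.unit ->
  exists v k h, [/\ v \is a GRing.unit, elemL k, elemL h & u = k * diag v * h].
Proof.
move=> uu.
have e'u0 : e' * u^-1 != 0.
  apply/eqP => e'u; have := oner_neq0 L.
  by rewrite -e'e -[e'](mulrVK uu) e'u !mul0r eqxx.
have [a [b [w E]]] := word_cancel e'u0.
set d := g b * wd w in E.
pose d' := wd' w * s b.
have d'd : d' * d = 1 by rewrite /d' /d -mulrA mulKs wd'_wd.
(* The row [f' * u^-1] is corrected so that it kills [d]; since [e' * f = 0], it remains a left
   inverse of [u * f]. *)
pose x := f' * u^-1 - f' * u^-1 * d * a * e' * u^-1.
have xd : x * d = 0.
  by rewrite mulrBl -!mulrA (mulrA e') (mulrA a) E mulr1 subrr.
have xuf : x * (u * f) = 1.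
  by rewrite mulrBl -!mulrA !mulKr // f'f e'f !mulr0 subr0.
(* This shear adds a multiple of [d] to the column [u * f] so that [d'] is a left inverse of the
   result [z]. *)
pose k1 := 1 + d * ((1 - d' * (u * f)) * x).
have Gk1 : elemL k1 by apply: elemL_nilp_word; rewrite -mulrA xd mulr0.
pose z := k1 * (u * f).
have zE : z = u * f + d * (1 - d' * (u * f)).
  by rewrite /z /k1 mulrDl mul1r -[_ * _ * (u * f)]mulrA -[_ * x * _]mulrA xuf
    mulr1.
have d'z : d' * z = 1.
  by rewrite zE mulrDr [d' * (d * _)]mulrA d'd mul1r addrC subrK.
(* Now [d] and [z] share the left inverse [d'], so [d'] kills [d - z] and the shear along it carries
   [z] to [d]. *)
pose k2 := 1 + (d - z) * d'.
have Gk2 : elemL k2.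
  by apply: elemL_nilp_word_star; rewrite -/d' mulrBr d'd d'z subrr.
have k2z : k2 * z = d by rewrite mulrDl mul1r -mulrA d'z mulr1 addrC subrK.
have [k3 Gk3 k3d] : exists2 k, elemL k & k * d = f.
  have [k Gk kd] := elemL_move_word b (wd'_wd w).
  (* A word beginning with [f] is moved to [e] first, and a second move takes [e] to [f]. *)
  move: kd; rewrite -/d; case: (b) => /= kd; last by exists k.
  have [h Gh he] := elemL_move_word false (mul1r (1 : L)).
  exists (h * k); first exact: elemLM.
  by rewrite -mulrA kd -he mulr1.
pose k := k3 * (k2 * k1).
have Gk : elemL k by do 2?apply: elemLM.
have kuf : k * u * f = f by rewrite /k -!mulrA -/z k2z.
pose v := e' * (k * u) * e; pose c := f' * (k * u) * e.
(* Since [k * u] fixes [f], its second column is that of the identity, and it is lower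
   triangular. *)
have ku : k * u = diag v * mx2 1 0 c 1.
  rewrite mx2M !(mulr1, mulr0, mul0r, mul1r, add0r, addr0) [LHS]mx2_entries.
  by rewrite -!(mulrA _ (k * u) f) kuf e'f f'f.
have uc : mx2 1 0 c 1 \is a GRing.unit := elemL_unit (elemL_lower c).
exists v, k^-1, (mx2 1 0 c 1); split.
- by rewrite -diag_unit -(unitrMl _ uc) -ku unitrMr // elemL_unit.
- exact: elemLV.
- exact: elemL_lower.
- by rewrite -[RHS]mulrA -ku mulKr // elemL_unit.
Qed.

(** * Normality of the elementary subgroup *)

Lemma diagV y : y \is a GRing.unit -> (diag y)^-1 = diag y^-1.
Proof.
move=> uy; rewrite -[LHS]mulr1 -diag1 -(mulrV uy) -diagM mulKr //.
by rewrite diag_unit.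
Qed.

(** In the decomposition of [unit_diag] the outer factors lie in G, and the middle one normalizes G
    by [elemL_diag_conj]. *)
Lemma elemL_conj u x : u \is a GRing.unit -> elemL x -> elemL (u * x * u^-1).
Proof.
move=> uu Gx; have [v [k [h [uv Gk Gh ->]]]] := unit_diag uu.
have [uk uh] := (elemL_unit Gk, elemL_unit Gh).
have uD : diag v \is a GRing.unit by rewrite diag_unit.
rewrite !invrM ?unitrMl // diagV //.
have -> : k * diag v * h * x * (h^-1 * (diag v^-1 * k^-1)) =
   k * (diag v * (h * x * h^-1) * diag v^-1) * k^-1 by rewrite !mulrA.
apply: elemLM (elemLV Gk); apply: elemLM => //; apply: elemL_diag_conj => //.
by apply: elemLM (elemLV Gh); exact: elemLM.
Qed.

Lemma unit_diagl u : u \is a GRing.unit ->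
  exists v k, [/\ v \is a GRing.unit, elemL k & u = k * diag v].
Proof.
move=> uu; have [v [k [h [uv Gk Gh ->]]]] := unit_diag uu.
have uD : diag v \is a GRing.unit by rewrite diag_unit.
exists v, (k * (diag v * h * (diag v)^-1)); split=> //.
  by apply: elemLM => //; exact: elemL_conj.
by rewrite -!mulrA mulVr // mulr1 !mulrA.
Qed.

(** Modulo the normal subgroup G every unit is diagonal, and commutators of diagonal units are
    handled by [elemL_diag_commutator]. *)
Lemma elemL_commutator x y : x \is a GRing.unit -> y \is a GRing.unit ->
  elemL (x * y * (y * x)^-1).
Proof.
move=> ux uy; have [v [k [uv Gk ->]]] := unit_diagl ux.
have [w [l [uw Gl ->]]] := unit_diagl uy.
have [uk ul] := (elemL_unit Gk, elemL_unit Gl).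
have uD z : z \is a GRing.unit -> diag z \is a GRing.unit by rewrite diag_unit.
have E (a b c d : L) : b \is a GRing.unit -> a * b * (c * d) = a * (b * c *
  b^-1) * (b * d).
  by move=> ub; rewrite -!mulrA mulKr.
rewrite (E k) ?uD // (E l) ?uD // !diagM.
have Gm a b c : b \is a GRing.unit -> elemL a -> elemL c -> elemL (a * (b * c *
  b^-1)).
  by move=> ub Ga Gc; apply: elemLM => //; exact: elemL_conj.
have Gl1 := Gm _ _ _ (uD _ uw) Gl Gk; have ul1 := elemL_unit Gl1.
have uwv : w * v \is a GRing.unit by rewrite unitrMl.
set X := k * _; set Y := l * _.
have -> : (Y * diag (w * v))^-1 = diag (w * v)^-1 * Y^-1.
  by rewrite [LHS]invrM ?uD // diagV.
have A4 (p q t u : L) : p * q * (t * u) = p * (q * t * u) by rewrite !mulrA.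
rewrite A4 diagM.
apply: elemLM; first by apply: Gm; rewrite ?uD.
by apply: elemLM; [exact: elemL_diag_commutator | exact: elemLV].
Qed.

(* As L^x/G turns out to be abelian, this is a normal subgroup of L^x. *)
Definition selem y := elemL (diag y).

Lemma selem1 : selem 1. Proof. by rewrite /selem diag1; exact: elemL1. Qed.

Lemma selemM x y : selem x -> selem y -> selem (x * y).
Proof. by rewrite /selem -diagM; exact: elemLM. Qed.

Lemma selem_unit y : selem y -> y \is a GRing.unit.
Proof. by move/elemL_unit; rewrite diag_unit. Qed.

Lemma selemV y : selem y -> selem y^-1.
Proof. by move=> Ny; rewrite /selem -diagV ?selem_unit //; exact: elemLV. Qed.

Lemma selem_nilp a b : b * a = 0 -> selem (1 + a * b).
Proof. exact: elemL_diag_nilp. Qed.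

Let swap_unit : mx2 0 1 1 0 \is a GRing.unit.
Proof.
by apply/unitrP; exists (mx2 0 1 1 0); rewrite !mx2M !simp2 mx2_1.
Qed.

Let swapV : (mx2 0 1 1 0)^-1 = mx2 0 1 1 0.
Proof.
by apply: (mulrI swap_unit); rewrite mulrV // mx2M !simp2 mx2_1.
Qed.

(** Elementary operations take both diag(1 + ab, 1) and diag(1, 1 + ba) to the matrix with rows (1,
    a) and (-b, 1). Conjugation by the swap, allowed by normality, brings [1 + b * a] to the lower
    corner. *)
Lemma selem_1addC a b : selem (1 + b * a) -> selem (1 + a * b).
Proof.
rewrite /selem /diag => Gba.
have Gba2 : elemL (mx2 1 0 0 (1 + b * a)).
  have := elemL_conj swap_unit Gba; rewrite swapV !mx2M !simp2; apply.
apply: (@elemL_mull _ (mx2 1 0 (- b) 1)); first exact: elemL_lower.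
apply: (@elemL_mulr (mx2 1 a 0 1)); first exact: elemL_upper.
have -> : mx2 1 a 0 1 * (mx2 (1 + a * b) 0 0 1 * mx2 1 0 (- b) 1) =
    mx2 1 0 (- b) 1 * (mx2 1 0 0 (1 + b * a) * mx2 1 a 0 1).
  by rewrite !mx2M !simp2 addrK addrC addrK.
apply: elemLM; first exact: elemL_lower.
by apply: elemLM => //; exact: elemL_upper.
Qed.

(* The unit carries the leaves ee, ef, f to e, ff, fe. *)
Lemma corner_shift : exists2 r, r \is a GRing.unit &
  forall y, r * diag (diag y) = diag y * r.
Proof.
have ff'ff' : f * f' * (f * f') + e * e' = 1.
  by rewrite -mulrA (mulKs true) addrC ee'ff'.
have rV : mx2 e' 0 (f * f') e * mx2 e (f * f') 0 e' = 1.
  by rewrite mx2M !simp2 e'e (mulrA e') e'f mul0r -mulrA f'e mulr0 ff'ff' mx2_1.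
have Vr : mx2 e (f * f') 0 e' * mx2 e' 0 (f * f') e = 1.
  rewrite mx2M !simp2 e'e (mulrA e') e'f mul0r -[f * f' * e]mulrA f'e mulr0.
  by rewrite addrC ff'ff' mx2_1.
have ur : mx2 e' 0 (f * f') e \is a GRing.unit.
  by apply/unitrP; exists (mx2 e (f * f') 0 e').
exists (mx2 e' 0 (f * f') e) => // y.
rewrite /diag -/(diag y) !mx2M !simp2 -(mulrA f f') /diag mul_e'_mx2 mul_f'_mx2.
by rewrite !simp2.
Qed.

(** By [corner_shift], [diag (diag y)] is conjugate to [diag y], and G is normal. *)
Lemma selem_diag y : selem (diag y) <-> selem y.
Proof.
have [r ur rE] := corner_shift; split=> Ny.
  by have := elemL_conj ur Ny; rewrite rE mulrK.
have urV : r^-1 \is a GRing.unit by rewrite unitrV.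
by have := elemL_conj urV Ny; rewrite invrK -mulrA -rE mulKr.
Qed.

(* In the abelian quotient by G, the class of diag(c, 1) equals that of
   diag(c, c, 1) over the leaves ee, ef, f, hence is trivial. *)
Lemma selem_scalar (c : K) : c != 0 -> selem c%:A.
Proof.
move=> c0; set A := diag c%:A; change (elemL A).
have uA : A \is a GRing.unit.
  rewrite diag_unit; apply/unitrP; exists (c^-1)%:A.
  by rewrite -!scalerAl !mul1r !scalerA mulVf ?divff ?scale1r.
have uDA : diag A \is a GRing.unit by rewrite diag_unit.
have [r ur rE] := corner_shift.
have DA : diag A = r^-1 * A * r by rewrite -mulrA -rE mulKr.
set k1 := r^-1 * A * (A * r^-1)^-1.
have Gk1 : elemL k1 by apply: elemL_commutator; rewrite ?unitrV.
have DAE : diag A = k1 * A.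
  by rewrite /k1 invrM ?unitrV // invrK -!mulrA mulVr // mulr1 !mulrA.
pose t := diag (mx2 0 1 1 0).
have ut : t \is a GRing.unit by rewrite diag_unit.
(* Scaling by [c] on the leaf e means scaling on both ee and ef; conjugation by [t] exchanges these
   two leaves. *)
have AE : A = diag A * (t * diag A * t^-1).
  rewrite /t diagV // !diagM swapV /A /diag !mx2M !simp2; congr mx2.
  rewrite /mx2 !simp2 -(scalerAl c 1) -(scalerAl c 1 f') !mul1r -!scalerAr.
  by rewrite -scalerDr ee'ff'.
set k2 := t * diag A * (diag A * t)^-1.
have Gk2 : elemL k2 by exact: elemL_commutator.
have tE : t * diag A * t^-1 = k2 * diag A.
  by rewrite /k2 invrM // -!mulrA mulVr // mulr1.
move: AE; rewrite tE DAE => AE.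
have E1 : k1 * A * (k2 * k1) = 1.
  by apply: (mulIr uA); rewrite mul1r -[k1 * A * _ * A]mulrA -(mulrA k2) -AE.
apply: (@elemL_mulr k1 A Gk1); apply: (@elemL_mull _ (k2 * k1)).
  exact: elemLM.
by rewrite E1; exact: elemL1.
Qed.

(** Here [1 - b * a] is the scalar -1, and [selem_1addC] transfers the conclusion to [1 - a * b]. *)
Lemma selem_reflection a b : b * a = 1 + 1 -> selem (1 - a * b).
Proof.
move=> ba; rewrite -mulNr; apply: selem_1addC; rewrite mulrN ba opprD addrA
  subrr.
rewrite sub0r -scaleN1r; apply: selem_scalar.
by rewrite oppr_eq0 oner_eq0.
Qed.

(** * Rectangular matrices as elements of L *)

Fixpoint comb n : 'rV[L]_n.+1 :=
  if n is m.+1 then row_mx f%:M (e *: comb m) else 1%:M.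

Fixpoint comb' n : 'cV[L]_n.+1 :=
  if n is m.+1 then col_mx f'%:M (comb' m *m e'%:M) else 1%:M.

Lemma combK n : comb n *m comb' n = 1%:M.
Proof.
elim: n => [|n IH] /=; first by rewrite mulmx1.
rewrite (mul_row_col f%:M) -scalar_mxM -scalemxAl mulmxA IH mul1mx.
by rewrite scale_scalar_mx -raddfD /= addrC ee'ff'.
Qed.

Lemma comb'K n : comb' n *m comb n = 1%:M.
Proof.
elim: n => [|n IH] /=; first by rewrite mulmx1.
rewrite (@mul_col_row L 1 n.+1 1 1 n.+1) -scalar_mxM f'f mul_scalar_mx scalerA
  f'e scale0r.
rewrite -!mulmxA -scalar_mxM e'f raddf0 mulmx0 mul_scalar_mx scalerA e'e.
by rewrite scale1r IH -scalar_mx_block.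
Qed.

(* A rectangular matrix is a map L^(m+1) -> L^(n+1) of right modules, turned
   into an element of L by the isomorphisms between L and its powers coming
   from the leaf sets f, ef, ..., e^(n-1)f, e^n. *)
Definition cl n m (A : 'M[L]_(n.+1, m.+1)) : L :=
  (comb n *m A *m comb' m) 0 0.

Lemma clM n p m (A : 'M[L]_(n.+1, p.+1)) (B : 'M[L]_(p.+1, m.+1)) :
  cl (A *m B) = cl A * cl B.
Proof.
have E : comb n *m (A *m B) *m comb' m =
    (comb n *m A *m comb' p) *m (comb p *m B *m comb' m).
  by rewrite !mulmxA -(mulmxA _ (comb' p)) comb'K mulmx1.
by rewrite /cl E [LHS]mxE big_ord1.
Qed.

Lemma clD n m (A B : 'M[L]_(n.+1, m.+1)) : cl (A + B) = cl A + cl B.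
Proof. by rewrite /cl mulmxDr mulmxDl [LHS]mxE. Qed.

Lemma cl0 n m : cl (0 : 'M[L]_(n.+1, m.+1)) = 0.
Proof. by rewrite /cl mulmx0 mul0mx mxE. Qed.

Lemma cl1 n : cl (1%:M : 'M[L]_n.+1) = 1.
Proof. by rewrite /cl mulmx1 combK mxE eqxx. Qed.

Lemma clK n m (A : 'M[L]_(n.+1, m.+1)) :
  A = comb' n *m (cl A)%:M *m comb m.
Proof.
by rewrite /cl -mx11_scalar !mulmxA comb'K mul1mx -mulmxA comb'K mulmx1.
Qed.

Lemma cl_unit_inv n m (A : 'M[L]_(n.+1, m.+1)) : cl A \is a GRing.unit ->
  exists2 B, A *m B = 1%:M & B *m A = 1%:M.
Proof.
move=> uA; exists (comb' m *m (cl A)^-1%:M *m comb n).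
  rewrite {1}[A]clK !mulmxA -(mulmxA _ (comb m)) combK mulmx1.
  by rewrite -(mulmxA _ (cl A)%:M) -scalar_mxM mulrV // mulmx1 comb'K.
rewrite {2}[A]clK !mulmxA -(mulmxA _ (comb n)) combK mulmx1.
by rewrite -(mulmxA _ (cl A)^-1%:M) -scalar_mxM mulVr // mulmx1 comb'K.
Qed.

Lemma selem_cl_nilp n k (P : 'M[L]_(n.+1, k.+1)) (Q : 'M[L]_(k.+1, n.+1)) :
  Q *m P = 0 -> selem (cl (1%:M + P *m Q)).
Proof.
by move=> QP; rewrite clD cl1 clM; apply: selem_nilp; rewrite -clM QP cl0.
Qed.

Lemma selem_cl_1addC n k (P : 'M[L]_(n.+1, k.+1)) (Q : 'M[L]_(k.+1, n.+1)) :
  selem (cl (1%:M + Q *m P)) -> selem (cl (1%:M + P *m Q)).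
Proof. by rewrite !clD !cl1 !clM; exact: selem_1addC. Qed.

(** The first leaf of [comb n.+1] is f and the others are those of [comb n] moved below e, so the
    new entry 1 occupies the corner f. *)
Lemma cl_block1 n m (A : 'M[L]_(n.+1, m.+1)) :
  cl (block_mx (1%:M : 'M_1) 0 0 A) = diag (cl A).
Proof.
rewrite /cl -[comb _]/(row_mx f%:M (e *: comb n)).
rewrite -[comb' _]/(col_mx f'%:M (comb' m *m e'%:M)).
rewrite (@mul_row_block L 1 1 n.+1 1 m.+1) !mulmx0 addr0 add0r mulmx1.
rewrite (mul_row_col f%:M) -scalar_mxM -scalemxAl mulmxA -scalemxAl -scalemxAl.
rewrite [comb n *m A *m _]mx11_scalar -scalar_mxM scale_scalar_mx -raddfD /=
  mxE.
by rewrite -mx11_scalar eqxx mulr1n diagE addrC mulrA.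
Qed.

Lemma cl_blockS k n m (A : 'M[L]_(n.+1, m.+1)) :
  cl (block_mx (1%:M : 'M_k.+2) 0 0 A) =
  diag (cl (block_mx (1%:M : 'M_k.+1) 0 0 A)).
Proof.
rewrite -cl_block1; apply: (congr1 (@cl _ _)).
have := block_mxAx (1%:M : 'M[L]_1) 0 0 0 (1%:M : 'M_k.+1) 0 0 0 A.
by rewrite /= castmx_id !col_mx0 !row_mx0 -scalar_mx_block => ->.
Qed.

Lemma selem_block1 k n m (A : 'M[L]_(n.+1, m.+1)) :
  selem (cl (block_mx (1%:M : 'M_k.+1) 0 0 A)) <-> selem (cl A).
Proof.
elim: k => [|k IH]; first by rewrite cl_block1; exact: selem_diag.
by rewrite cl_blockS selem_diag.
Qed.

Lemma unit_block1 k n m (A : 'M[L]_(n.+1, m.+1)) :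
  (cl (block_mx (1%:M : 'M_k.+1) 0 0 A) \is a GRing.unit) =
  (cl A \is a GRing.unit).
Proof.
elim: k => [|k IH]; first by rewrite cl_block1 diag_unit.
by rewrite cl_blockS diag_unit.
Qed.

Definition unit_selem y := y \is a GRing.unit -> selem y.

Lemma unit_selem_mul x y z :
  selem x -> selem y -> unit_selem (x * z * y) <-> unit_selem z.
Proof.
move=> Nx Ny; have [ux uy] := (selem_unit Nx, selem_unit Ny).
rewrite /unit_selem (unitrMl _ uy) (unitrMr _ ux).
split=> Nz uz; last by apply: selemM => //; apply: selemM => //; exact: Nz.
have := selemM (selemM (selemV Nx) (Nz uz)) (selemV Ny).
by rewrite !mulrA mulVr // mul1r mulrK.
Qed.

(** Block elimination: the Schur complement, bordered by an identity block, stands between two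
    unitriangular factors. These have the form [1 + P Q] with [Q P = 0], hence trivial class. *)
Lemma unit_selem_border k n m (r : 'M[L]_(k.+1, m.+1)) (q : 'M[L]_(n.+1, k.+1))
  h :
  unit_selem (cl (block_mx 1%:M r q h)) <-> unit_selem (cl (h - q *m r)).
Proof.
have -> : block_mx 1%:M r q h =
    block_mx 1%:M 0 q 1%:M *m block_mx 1%:M 0 0 (h - q *m r) *m block_mx 1%:M r
      0 1%:M.
  by rewrite !mulmx_block !(mulmx1, mulmx0, mul1mx, mul0mx, addr0, add0r) addrC
    subrK.
rewrite [X in _ <-> X]/unit_selem -(unit_block1 k) -(selem_block1 k)
  -/(unit_selem _).
rewrite !clM; apply: unit_selem_mul.
  have -> : block_mx 1%:M 0 q 1%:M = 1%:M + col_mx 0 1%:M *m row_mx q 0.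
    rewrite mul_col_row !(mulmx0, mul1mx, mul0mx) [X in X + _]scalar_mx_block.
    by rewrite add_block_mx !(addr0, add0r).
  by apply: selem_cl_nilp; rewrite (@mul_row_col L _ k.+1) !(mulmx0, mulmx1,
    mul0mx) addr0.
have -> : block_mx 1%:M r 0 1%:M = 1%:M + col_mx 1%:M 0 *m row_mx 0 r.
  rewrite mul_col_row !(mulmx0, mul1mx, mul0mx) [X in X + _]scalar_mx_block.
  by rewrite add_block_mx !(addr0, add0r).
by apply: selem_cl_nilp; rewrite (@mul_row_col L _ k.+1) !(mulmx0, mulmx1,
  mul0mx) addr0.
Qed.

(** * Linear pencils *)

Local Notation cst := (map_mx (in_alg L)).

Lemma scale_mul_cst n p m x (A : 'M[K]_(n, p)) (Y : 'M[L]_(p, m)) :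
  cst A *m (x *: Y) = x *: (cst A *m Y).
Proof.
apply/matrixP => i j; rewrite !mxE mulr_sumr; apply: eq_bigr => k _.
by rewrite !mxE /= mulr_algl mulr_algl scalerAr.
Qed.

Lemma cst_mul_scalar n m x (A : 'M[K]_(n, m)) :
  cst A *m x%:M = x%:M *m cst A.
Proof.
apply/matrixP => i j; rewrite mul_scalar_mx -[x%:M]mulmx1 mul_scalar_mx.
by rewrite scale_mul_cst mulmx1 !mxE.
Qed.

Lemma cst_inj n m : injective (cst : 'M[K]_(n, m) -> 'M[L]_(n, m)).
Proof.
move=> A B /matrixP AB; apply/matrixP => i j; have := AB i j; rewrite !mxE.
exact: fmorph_inj.
Qed.

Lemma cst1 n : cst (1%:M : 'M[K]_n) = 1%:M. Proof. exact: map_mx1. Qed.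

Definition pencil n m (T0 T1 T2 : 'M[K]_(n, m)) : 'M[L]_(n, m) :=
  cst T0 + (e *: cst T1 + f *: cst T2).

Lemma mul_cst_pencil n p m (A : 'M[K]_(n, p)) (T0 T1 T2 : 'M[K]_(p, m)) :
  cst A *m pencil T0 T1 T2 = pencil (A *m T0) (A *m T1) (A *m T2).
Proof. by rewrite /pencil !mulmxDr !scale_mul_cst !map_mxM. Qed.

Lemma pencil_mul_cst n p m (A : 'M[K]_(p, m)) (T0 T1 T2 : 'M[K]_(n, p)) :
  pencil T0 T1 T2 *m cst A = pencil (T0 *m A) (T1 *m A) (T2 *m A).
Proof. by rewrite /pencil !mulmxDl -!scalemxAl !map_mxM. Qed.

Lemma pencil_row n m1 m2 (A0 A1 A2 : 'M[K]_(n, m1)) (B0 B1 B2 : 'M[K]_(n, m2)) :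
  pencil (row_mx A0 B0) (row_mx A1 B1) (row_mx A2 B2) =
  row_mx (pencil A0 A1 A2) (pencil B0 B1 B2).
Proof. by rewrite /pencil !map_row_mx !scale_row_mx !add_row_mx. Qed.

Lemma pencil_col n1 n2 m (A0 A1 A2 : 'M[K]_(n1, m)) (B0 B1 B2 : 'M[K]_(n2, m)) :
  pencil (col_mx A0 B0) (col_mx A1 B1) (col_mx A2 B2) =
  col_mx (pencil A0 A1 A2) (pencil B0 B1 B2).
Proof. by rewrite /pencil !map_col_mx !scale_col_mx !add_col_mx. Qed.

Lemma pencil_cst n m (A : 'M[K]_(n, m)) : pencil A 0 0 = cst A.
Proof. by rewrite /pencil !map_mx0 !scaler0 !addr0. Qed.

Lemma selemI x y : selem x -> x * y = 1 -> selem y.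
Proof.
move=> Nx xy; suff -> : y = x^-1 by exact: selemV.
by apply: (mulrI (selem_unit Nx)); rewrite xy mulrV ?selem_unit.
Qed.

(** * Completing vectors over [K] to invertible matrices *)

Lemma cl_cst11 (c : K) : cl (cst (c%:M : 'M_1)) = c%:A.
Proof. by rewrite /cl mul1mx mulmx1 !mxE eqxx. Qed.

(** A rank one perturbation [1 + a b] has inverse [1 - c^-1 a b], and [selem_cl_1addC] trades its
    class for that of the scalar [c]. *)
Lemma selem_rank1 n (a : 'cV[K]_n.+1) (b : 'rV[K]_n.+1) c :
  1%:M + b *m a = c%:M -> c != 0 ->
  exists h, [/\ (1%:M + a *m b) *m h = 1%:M, h *m (1%:M + a *m b) = 1%:M,
    selem (cl (cst (1%:M + a *m b))) & selem (cl (cst h))].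
Proof.
move=> ba c0; pose h := 1%:M - c^-1 *: (a *m b).
have abab : a *m b *m (a *m b) = (c - 1) *: (a *m b).
  have -> : a *m b *m (a *m b) = a *m (b *m a) *m b by rewrite !mulmxA.
  have -> : b *m a = (c - 1)%:M by rewrite raddfB /= -ba addrC addKr.
  by rewrite mul_mx_scalar -scalemxAl.
have abc : a *m b + (c - 1) *: (a *m b) = c *: (a *m b).
  by rewrite -{1}[a *m b]scale1r -scalerDl addrC subrK.
have gh : (1%:M + a *m b) *m h = 1%:M.
  rewrite /h mulmxBr mulmx1 -scalemxAr mulmxDl mul1mx abab abc scalerA.
  by rewrite mulVf // scale1r addrK.
have hg : h *m (1%:M + a *m b) = 1%:M.
  rewrite /h mulmxBl mul1mx -scalemxAl mulmxDr mulmx1 abab abc scalerA.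
  by rewrite mulVf // scale1r addrK.
have Ng : selem (cl (cst (1%:M + a *m b))).
  rewrite map_mxD map_mxM cst1; apply: selem_cl_1addC.
  by rewrite -map_mxM -cst1 -map_mxD ba cl_cst11; exact: selem_scalar.
exists h; split=> //; apply: (selemI Ng).
by rewrite -clM -map_mxM gh cst1 cl1.
Qed.

(** The leading coordinate 1 is what lets the rank one update in [row_completion] replace the first
    row of the identity by [l]. *)
Lemma dual_vector n (l : 'rV[K]_(1 + n)) : l != 0 ->
  exists a : 'cV_n, exists2 c : K, c != 0 & l *m col_mx 1%:M a = c%:M.
Proof.
rewrite -[l]hsubmxK [lsubmx l]mx11_scalar; set c := lsubmx l 0 0.
move=> l0; have [c0|c0] := eqVneq c 0; last first.
  by exists 0, c => //; rewrite mul_row_col mulmx1 mulmx0 addr0.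
have [j lj] : exists j, rsubmx l 0 j != 0.
  apply/existsP; apply: contraNT l0; rewrite negb_exists => /forallP r0.
  rewrite c0 raddf0; apply/eqP; suff -> : rsubmx l = 0 by rewrite row_mx0.
  by apply/rowP => j; rewrite [RHS]mxE; apply/eqP; have := r0 j; rewrite negbK.
exists (delta_mx j 0), (rsubmx l 0 j) => //.
rewrite mul_row_col c0 raddf0 mul0mx add0r -colE [LHS]mx11_scalar.
by rewrite mxE.
Qed.

Lemma row_completion n (l : 'rV[K]_n.+1) : l != 0 ->
  exists (g' : 'M[K]_(n, n.+1)) (h : 'M[K]_n.+1),
    [/\ (col_mx l g' : 'M_n.+1) *m h = 1%:M,
        selem (cl (cst (col_mx l g' : 'M_n.+1))) & selem (cl (cst h))].
Proof.
move=> l0; have [a [c c0 lc]] := @dual_vector n l l0.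
(* With [d] the first basis row, the first row of [1 + col_mx 1 a (l - d)] is [d + (l - d) = l]. *)
pose d : 'rV[K]_(1 + n) := row_mx 1%:M 0.
have ba : 1%:M + (l - d) *m col_mx 1%:M a = c%:M.
  by rewrite mulmxBl lc /d (@mul_row_col K 1 1 n) mulmx1 mul0mx addr0 addrCA
    subrr addr0.
have [h [gh hg Ng Nh]] := selem_rank1 ba c0.
pose g' := (row_mx 0 1%:M : 'M[K]_(n, 1 + n)) + a *m (l - d).
suff E : 1%:M + col_mx 1%:M a *m (l - d) = col_mx l g' by exists g', h; rewrite
  -E.
rewrite mul_col_mx mul1mx [1%:M in LHS](@scalar_mx_block K 1 n) block_mxEv -/d.
by rewrite add_col_mx addrCA subrr addr0.
Qed.

Lemma col_completion n (l : 'cV[K]_n.+1) : l != 0 ->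
  exists (g' : 'M[K]_(n.+1, n)) (h : 'M[K]_n.+1),
    [/\ h *m (row_mx l g' : 'M_n.+1) = 1%:M,
        selem (cl (cst (row_mx l g' : 'M_n.+1))) & selem (cl (cst h))].
Proof.
move=> l0; have [|a [c c0 lc]] := @dual_vector n l^T; first by rewrite trmx_eq0.
pose d : 'cV[K]_(1 + n) := col_mx 1%:M 0.
have {}lc : row_mx 1%:M a^T *m l = c%:M.
  by rewrite -[LHS]trmxK trmx_mul tr_row_mx trmx1 trmxK lc tr_scalar_mx.
have ba : 1%:M + row_mx 1%:M a^T *m (l - d) = c%:M.
  by rewrite mulmxBr lc /d (@mul_row_col K 1 1 n) mulmx1 mulmx0 addr0 addrCA
    subrr addr0.
have [h [gh hg Ng Nh]] := selem_rank1 ba c0.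
pose g' := (col_mx 0 1%:M : 'M[K]_(1 + n, n)) + (l - d) *m a^T.
suff E : 1%:M + (l - d) *m row_mx 1%:M a^T = row_mx l g' by exists g', h;
  rewrite -E.
rewrite mul_mx_row mulmx1 [1%:M in LHS](@scalar_mx_block K 1 n) block_mxEh -/d.
by rewrite (@add_row_mx K n.+1 1 n) addrCA subrr addr0.
Qed.

(* Empty matrices have no image under [cl], and are good by convention. *)
Definition good n m : 'M[L]_(n, m) -> Prop :=
  match n, m with
  | n'.+1, m'.+1 => fun X => unit_selem (cl X)
  | _, _ => fun _ => True
  end.

(** For nonempty [h] this is the Schur complement. For empty [h] the bordered matrix is 1, or else a
    single row (1, r) or column (1, q) of larger size, which has a nonzero right or left annihilator
    and so is not invertible. *)
Lemma good_shrink n m (r : 'M[L]_(1, m)) (q : 'M[L]_(n, 1)) h :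
  good (h - q *m r) -> good (block_mx 1%:M r q h : 'M_(1 + n, 1 + m)).
Proof.
case: n m r q h => [|n] [|m] r q h; rewrite /good /unit_selem.
- move=> _ _; rewrite [r]thinmx0 [q]flatmx0 [h]flatmx0 -[0 : 'M_0](flatmx0
  1%:M).
  by rewrite -(@scalar_mx_block L 1 0) cl1; exact: selem1.
- move=> _ /cl_unit_inv[B _ BZ]; suff Z0 : (1%:M : 'M[L]_m.+1) = 0.
    have := congr1 (fun A : 'M[L]_m.+1 => A 0 0) Z0.
    by rewrite !mxE eqxx => /eqP; rewrite oner_eq0.
  have Z : block_mx 1%:M r q h *m col_mx (- r) 1%:M = 0.
    rewrite (@mul_block_col L 1 0 1 m.+1) [q *m _ + _]flatmx0.
    by rewrite mul1mx mulmx1 addNr col_mx0.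
  have := congr1 (mulmx B) Z; rewrite mulmxA BZ mul1mx mulmx0.
  by rewrite -[0](@col_mx0 L 1 m.+1) => /(@eq_col_mx L 1 m.+1)[].
- move=> _ /cl_unit_inv[B ZB _]; suff Z0 : (1%:M : 'M[L]_n.+1) = 0.
    have := congr1 (fun A : 'M[L]_n.+1 => A 0 0) Z0.
    by rewrite !mxE eqxx => /eqP; rewrite oner_eq0.
  have Z : row_mx (- q) 1%:M *m block_mx 1%:M r q h = 0.
    rewrite (@mul_row_block L n.+1 1 n.+1 1 0) [_ *m r + _]thinmx0.
    by rewrite mul1mx mulmx1 addNr row_mx0.
  have := congr1 (mulmx^~ B) Z; rewrite /= -mulmxA ZB mulmx1 mul0mx.
  by rewrite -[0](@row_mx0 L n.+1 1 n.+1) => /(@eq_row_mx L n.+1 1 n.+1)[].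
- exact: (@unit_selem_border 0 n m r q h).2.
Qed.

Lemma good_cst_mul n m (g1 : 'M[K]_n.+1) (T : 'M[L]_(n.+1, m.+1)) (h1 :
  'M[K]_m.+1) :
  selem (cl (cst g1)) -> selem (cl (cst h1)) ->
  good (cst g1 *m T *m cst h1) -> good T.
Proof. by move=> Ng Nh; rewrite /good !clM; by rewrite unit_selem_mul. Qed.

(** The number of rows is left free: splitting a row raises it, while the induction lowers the
    number of columns. *)
Definition good_width m := forall n (T0 T1 T2 : 'M[K]_(n, m)), good (pencil T0
  T1 T2).

(** Invertibility makes the constant row [l *m T0] nonzero, so base changes over [K] turn it into
    (1, 0, ..., 0). Its border then vanishes to the right, and the Schur complement is again a
    pencil, with one column fewer. *)
Lemma good_const_row n m (T0 T1 T2 : 'M[K]_(n.+1, m.+1)) (l : 'rV[K]_n.+1) :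
  good_width m -> l != 0 -> l *m T1 = 0 -> l *m T2 = 0 ->
  good (pencil T0 T1 T2).
Proof.
move=> IH l0 lT1 lT2; pose T := pencil T0 T1 T2.
have [g1 [g1' [gg Ng _]]] := row_completion l0.
move=> uT; have [B TB BT] := cl_unit_inv uT.
have r0 : l *m T0 != 0.
  apply: contraNneq l0 => lT0; apply/eqP/cst_inj.
  rewrite map_mx0 -[LHS]mulmx1 -TB mulmxA mul_cst_pencil lT0 lT1 lT2.
  by rewrite pencil_cst map_mx0 mul0mx.
have [h1 [h1' [hh _ Nh]]] := row_completion r0.
have lh : l *m T0 *m h1' = (row_mx 1%:M 0 : 'rV_(1 + m)).
  move: hh; rewrite (@mul_col_mx K 1 m) (@scalar_mx_block K 1 m) block_mxEv.
  by case/(@eq_col_mx K 1 m).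
apply: (good_cst_mul Ng Nh) uT.
rewrite mul_cst_pencil pencil_mul_cst !(@mul_col_mx K 1 n) lT1 lT2 !mul0mx lh.
rewrite (@pencil_col 1 n) pencil_cst.
rewrite -[g1 *m T0 *m h1'](@hsubmxK K n 1 m) -[g1 *m T1 *m h1'](@hsubmxK K n 1
  m).
rewrite -[g1 *m T2 *m h1'](@hsubmxK K n 1 m) (@pencil_row n 1 m).
rewrite (@map_row_mx _ _ _ 1 1 m) map_mx0 cst1 -(@block_mxEv L 1 n 1 m).
by apply: good_shrink; rewrite mulmx0 subr0; exact: IH.
Qed.

(** The same reduction by columns: the constant column [T0 *m v] becomes the first basis vector. *)
Lemma good_const_col n m (T0 T1 T2 : 'M[K]_(n.+1, m.+1)) (v : 'cV[K]_m.+1) :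
  good_width m -> v != 0 -> T1 *m v = 0 -> T2 *m v = 0 ->
  good (pencil T0 T1 T2).
Proof.
move=> IH v0 T1v T2v; pose T := pencil T0 T1 T2.
have [h1 [h1' [hh Nh _]]] := col_completion v0.
move=> uT; have [B TB BT] := cl_unit_inv uT.
have c0 : T0 *m v != 0.
  apply: contraNneq v0 => T0v; apply/eqP/cst_inj.
  rewrite map_mx0 -[LHS]mul1mx -BT -mulmxA pencil_mul_cst T0v T1v T2v.
  by rewrite pencil_cst map_mx0 mulmx0.
have [g1 [g1' [gg _ Ng]]] := col_completion c0.
have gv : g1' *m (T0 *m v) = (col_mx 1%:M 0 : 'cV_(1 + n)).
  move: gg; rewrite (@mul_mx_row K _ _ 1 n) (@scalar_mx_block K 1 n) block_mxEh.
  by case/(@eq_row_mx K n.+1 1 n).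
apply: (good_cst_mul Ng Nh) uT.
rewrite mul_cst_pencil pencil_mul_cst !(@mul_mx_row K _ _ 1 m) -!(mulmxA _ _ v).
rewrite T1v T2v !mulmx0 gv (@pencil_row n.+1 1 m) pencil_cst.
rewrite -[g1' *m T0 *m h1](@vsubmxK K 1 n m) -[g1' *m T1 *m h1](@vsubmxK K 1 n
  m).
rewrite -[g1' *m T2 *m h1](@vsubmxK K 1 n m) (@pencil_col 1 n m).
rewrite (@map_col_mx _ _ _ 1 n 1) map_mx0 cst1 -(@block_mxEh L 1 n 1 m).
by apply: good_shrink; rewrite mul0mx subr0; exact: IH.
Qed.

(** * Splitting a leaf into its two children *)

Lemma selem_swap : selem (mx2 0 1 1 0).
Proof.
suff -> : mx2 0 1 1 0 = 1 - (e - f) * (e' - f').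
  by apply: selem_reflection; rewrite mulrBl !mulrBr e'e e'f f'e f'f subr0
    sub0r opprK.
apply/eqP; rewrite eq_sym subr_eq eq_sym; apply/eqP.
rewrite /mx2 !mul0r !mul1r add0r addr0 mulrBl !mulrBr opprB addrACA.
by rewrite [e * f' + _]addrC subrK [f * e' + _]addrC subrK ee'ff'.
Qed.

(** This unit exchanges the leaves e and fe and fixes ff; it is a reflection along [e - f * e]. *)
Lemma selem_swap_word : selem (mx2 0 e' e (f * f')).
Proof.
suff -> : mx2 0 e' e (f * f') = 1 - (e - f * e) * (e' - e' * f').
  apply: selem_reflection; rewrite mulrBl !mulrBr e'e mulrA e'f mul0r subr0.
  rewrite -[e' * f' * e]mulrA f'e mulr0 sub0r -[e' * f' * _]mulrA.
  by rewrite (mulKs true) e'e opprK.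
apply/eqP; rewrite eq_sym subr_eq eq_sym; apply/eqP.
have E1 (x y : L) : x + (y - x) = y by rewrite addrC subrK.
have E2 (x y z : L) : x + y + (z - x) = z + y by rewrite addrC addrA subrK.
rewrite /mx2 mul0r add0r mulrBl !mulrBr opprB mulrDr !mulrA addrACA E1 E2.
have -> : f * e * e' * f' + f * f * f' * f' = f * (e * e' + f * f') * f'.
  by rewrite mulrDr mulrDl !mulrA.
by rewrite ee'ff' mulr1 ee'ff'.
Qed.

(** Seen through [comb], the splitting matrix only permutes leaves; for [n = 0] it is the swap of e
    and f. *)
Lemma selem_split_row n :
  selem (cl (col_mx (row_mx e%:M (row_mx f%:M 0)) (row_mx 0 (row_mx 0 1%:M)) :
             'M[L]_(1 + n, 1 + (1 + n)))).
Proof.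
case: n => [|n].
  have comb0 : comb 0 = row_mx 1%:M (0 : 'M_(1, 0)).
    by apply/rowP => i; rewrite [RHS]mxE; case: splitP => [j _|[]//]; rewrite
      !mxE !ord1.
  have e'0 : e'%:M = col_mx e'%:M (0 : 'M_(0, 1)).
    by apply/colP => i; rewrite [RHS]mxE; case: splitP => [j _|[]//]; rewrite
      !mxE !ord1.
  rewrite /cl -[comb' _]/(col_mx f'%:M (1%:M *m e'%:M)) mul1mx comb0.
  rewrite (@mul_row_col L 1 1 0) mul1mx mul0mx addr0 (@mul_row_col L 1 1 1) e'0.
  rewrite (@mul_row_col L 1 1 0) mul0mx addr0 -!scalar_mxM -raddfD /= mxE eqxx.
  by have := selem_swap; rewrite /mx2 !mul0r !mul1r add0r addr0 addrC mulr1n.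
rewrite /cl -[comb _]/(row_mx f%:M (e *: comb n)).
rewrite -[comb' _]/(col_mx f'%:M (col_mx f'%:M (comb' n *m e'%:M) *m e'%:M)).
rewrite (@mul_row_col L 1 1 n.+1) (@mul_mx_row L 1 1 1 (1 + n.+1)).
rewrite (@mul_mx_row L 1 1 1 n.+1) (@mul_mx_row L 1 n.+1 1 (1 + n.+1)).
rewrite (@mul_mx_row L 1 n.+1 1 n.+1) !mul_scalar_mx !scaler0 !mulmx0 !mulmx1.
rewrite (@add_row_mx L 1 1 (1 + n.+1)) (@add_row_mx L 1 1 n.+1) !addr0 !add0r.
rewrite (@mul_row_col L 1 1 (1 + n.+1)) (@mul_col_mx L 1 n.+1).
rewrite (@mul_row_col L 1 1 n.+1) -(mulmxA (comb' n)).
rewrite (mulmxA (e *: comb n)) -[e *: comb n *m comb' n]scalemxAl combK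
  -!scalemxAl.
rewrite mul1mx -!scalar_mxM.
rewrite !scale_scalar_mx -!raddfD /= mxE eqxx mulr1n !mulrA.
(* The left side carries the leaves f, ef, ee to fe, ff, e: first e and f are swapped, then e and
   fe. *)
suff -> : f * e * f' + (f * f * f' * e' + e * e' * e') =
    mx2 0 e' e (f * f') * mx2 0 1 1 0.
  by apply: selemM selem_swap_word selem_swap.
rewrite mx2M !simp2 /mx2 mul0r addr0 mulrDr !mulrA addrC -addrA addrCA.
by rewrite addrA.
Qed.

(* If l T0 = 0, the row l T equals e r1 + f r2 with r1, r2 constant, and splitting
   the corresponding leaf replaces it by the two constant rows r1 and r2. *)
Lemma good_split_row n m (T0 T1 T2 : 'M[K]_(n.+1, m.+1)) (l : 'rV[K]_n.+1) :
  good_width m -> l != 0 -> l *m T0 = 0 -> good (pencil T0 T1 T2).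
Proof.
move=> IH l0 lT0.
have [g1 [g1' [gg Ng _]]] := row_completion l0.
have N1 : selem (cl (cst (1%:M : 'M[K]_m.+1))) by rewrite cst1 cl1; exact:
  selem1.
apply: (good_cst_mul Ng N1).
rewrite cst1 mulmx1 mul_cst_pencil !(@mul_col_mx K 1 n) lT0 (@pencil_col 1 n).
pose X := col_mx (row_mx e%:M (row_mx f%:M 0)) (row_mx 0 (row_mx 0 1%:M)) :
  'M[L]_(1 + n, 1 + (1 + n)).
pose R := pencil (col_mx (l *m T1) (col_mx (l *m T2) (g1 *m T0)))
  (col_mx 0 (col_mx 0 (g1 *m T1))) (col_mx 0 (col_mx 0 (g1 *m T2))).
have XR : X *m R = col_mx (pencil 0 (l *m T1) (l *m T2))
                          (pencil (g1 *m T0) (g1 *m T1) (g1 *m T2)).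
  rewrite /R /X (@pencil_col 1 (1 + n)) (@pencil_col 1 n) !pencil_cst.
  rewrite mul_col_mx !mul_row_col !mul_scalar_mx scale1r !mul0mx !add0r addr0.
  by rewrite {2}/pencil map_mx0 add0r.
have GR : good R.
  apply: (@good_const_row _ _ _ _ _ (row_mx 1%:M 0)) => //.
  - apply/eqP => /(congr1 (fun A : 'rV[K]_(1 + (1 + n)) => A 0 0)) /eqP.
    by rewrite mxE; case: splitP => // j _; rewrite !mxE [j]ord1 oner_eq0.
  - by rewrite (@mul_row_col K 1 1 (1 + n)) mulmx0 mul0mx addr0.
  - by rewrite (@mul_row_col K 1 1 (1 + n)) mulmx0 mul0mx addr0.
move: GR; rewrite -XR /good /unit_selem clM => GR uXR.
have NX := selem_split_row n.
by apply: selemM => //; apply: GR; rewrite -(unitrMr _ (selem_unit NX)).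
Qed.

(** * Degrees and Horner components of polynomial matrices *)

Lemma hpol_cst D (c : K) : hpol D c%:A.
Proof.
elim: D c => [|D IH] c /=; first by exists c.
exists c, 0, 0; rewrite !mulr0 !addr0; split=> //.
  by rewrite -[0](scale0r 1); exact: IH.
by rewrite -[0](scale0r 1); exact: IH.
Qed.

Lemma hpol0 D : hpol D 0.
Proof. by rewrite -[0](scale0r 1); exact: hpol_cst. Qed.

Lemma hpolD D p q : hpol D p -> hpol D q -> hpol D (p + q).
Proof.
elim: D p q => [|D IH] p q /=.
  by move=> [c ->] [d ->]; exists (c + d); rewrite scalerDl.
move=> [c [p1 [p2 [h1 h2 ->]]]] [d [q1 [q2 [k1 k2 ->]]]].
exists (c + d), (p1 + q1), (p2 + q2); split; [exact: IH|exact: IH|].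
by rewrite scalerDl !mulrDr addrACA (addrACA c%:A).
Qed.

Lemma hpolZ D (a : K) p : hpol D p -> hpol D (a *: p).
Proof.
elim: D p => [|D IH] p /=; first by move=> [c ->]; exists (a * c); rewrite
  scalerA.
move=> [c [p1 [p2 [h1 h2 ->]]]]; exists (a * c), (a *: p1), (a *: p2).
by split; [exact: IH|exact: IH|]; rewrite !scalerDr scalerA !scalerAr.
Qed.

Lemma hpolS D p : hpol D p -> hpol D.+1 p.
Proof.
elim: D p => [|D IH] p; first by move=> [c ->]; exact: hpol_cst.
move=> [c [p1 [p2 [h1 h2 ->]]]].
by exists c, p1, p2; split=> //; exact: IH.
Qed.

Lemma hpol_le D D' p : (D <= D')%N -> hpol D p -> hpol D' p.
Proof.
move=> /subnK <-; elim: (D' - D)%N => [|k IH] // /IH; exact: hpolS.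
Qed.

Lemma hpol_sum D I (r : seq I) (F : I -> L) :
  (forall i, hpol D (F i)) -> hpol D (\sum_(i <- r) F i).
Proof.
move=> hF; elim/big_rec: _ => [|i x _ hx]; [exact: hpol0 | exact: hpolD].
Qed.

Lemma hpol_gl D b p : hpol D p -> hpol D.+1 (g b * p).
Proof.
move=> hp; case: b; [exists 0, 0, p|exists 0, p, 0].
all: rewrite scale0r mulr0 ?add0r ?addr0; split=> //; exact: hpol0.
Qed.

Lemma poly_wd w : poly (wd w).
Proof.
elim: w => [|b w [D hw]].
  by exists 0%N, 1; rewrite /wd big_nil scale1r.
by exists D.+1; rewrite /wd big_cons; exact: hpol_gl.
Qed.

Lemma polyD p q : poly p -> poly q -> poly (p + q).
Proof.
move=> [D hp] [D' hq]; exists (maxn D D'); apply: hpolD.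
  exact: hpol_le (leq_maxl _ _) hp.
exact: hpol_le (leq_maxr _ _) hq.
Qed.

Lemma polyZ (a : K) p : poly p -> poly (a *: p).
Proof. by move=> [D hp]; exists D; exact: hpolZ. Qed.

Lemma poly_sum I (r : seq I) (F : I -> L) :
  (forall i, poly (F i)) -> poly (\sum_(i <- r) F i).
Proof.
move=> hF; elim/big_rec: _ => [|i x _ hx]; last exact: polyD.
by exists 0%N; exact: hpol0.
Qed.

Definition hpolmx D n m (Y : 'M[L]_(n, m)) := forall i j, hpol D (Y i j).

Lemma hpolmxP n m (Y : 'M[L]_(n, m)) :
  (forall i j, poly (Y i j)) -> exists D, hpolmx D Y.
Proof.
move=> hY.
have /choice[F FP] (ij : 'I_n * 'I_m) : exists D, hpol D (Y ij.1 ij.2).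
  exact: hY.
exists (\max_ij F ij) => i j; apply: hpol_le (FP (i, j)).
exact: (leq_bigmax (i, j)).
Qed.

Lemma hpolmx0P n m (Y : 'M[L]_(n, m)) : hpolmx 0 Y -> exists C, Y = cst C.
Proof.
move=> hY.
have /choice[F FP] (ij : 'I_n * 'I_m) : exists c : K, Y ij.1 ij.2 = c%:A.
  exact: hY.
exists (\matrix_(i, j) F (i, j)); apply/matrixP => i j.
by rewrite !mxE (FP (i, j)).
Qed.

Lemma hpolmxSP D n m (Y : 'M[L]_(n, m)) : hpolmx D.+1 Y ->
  exists C Y1 Y2, [/\ hpolmx D Y1, hpolmx D Y2 &
    Y = cst C + (e *: Y1 + f *: Y2)].
Proof.
move=> hY.
have /choice[F FP] (ij : 'I_n * 'I_m) : exists t : K * (L * L),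
    [/\ hpol D t.2.1, hpol D t.2.2 &
        Y ij.1 ij.2 = t.1%:A + e * t.2.1 + f * t.2.2].
  by have [c [p [q h]]] := hY ij.1 ij.2; exists (c, (p, q)).
exists (\matrix_(i, j) (F (i, j)).1), (\matrix_(i, j) (F (i, j)).2.1),
  (\matrix_(i, j) (F (i, j)).2.2).
split; try by move=> i j; rewrite mxE; case: (FP (i, j)).
by apply/matrixP => i j; rewrite !mxE addrA; case: (FP (i, j)).
Qed.

Lemma hpolmx_eq0 D n m (C : 'M[K]_(n, m)) (Y1 Y2 : 'M[L]_(n, m)) :
  hpolmx D Y1 -> hpolmx D Y2 -> cst C + (e *: Y1 + f *: Y2) = 0 ->
  [/\ C = 0, Y1 = 0 & Y2 = 0].
Proof.
move=> h1 h2 /matrixP Y0.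
have E i j : [/\ C i j = 0, Y1 i j = 0 & Y2 i j = 0].
  apply: (@hpol_eq0 D); [exact: h1|exact: h2|].
  by have := Y0 i j; rewrite !mxE addrA.
by split; apply/matrixP => i j; have [] := E i j; rewrite !mxE.
Qed.

Lemma hpolmxD D n m (Y Z : 'M[L]_(n, m)) :
  hpolmx D Y -> hpolmx D Z -> hpolmx D (Y + Z).
Proof. by move=> hY hZ i j; rewrite mxE; exact: hpolD. Qed.

Lemma hpolmx_cst_mul D n p m (A : 'M[K]_(n, p)) (Y : 'M[L]_(p, m)) :
  hpolmx D Y -> hpolmx D (cst A *m Y).
Proof.
move=> hY i j; rewrite mxE; apply: hpol_sum => k.
by rewrite mxE /= mulr_algl; exact: hpolZ.
Qed.

Lemma hpolmxN D n m (Y : 'M[L]_(n, m)) : hpolmx D Y -> hpolmx D (- Y).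
Proof. by move=> hY i j; rewrite mxE -scaleN1r; exact: hpolZ. Qed.

Lemma hpolmxS D n m (Y : 'M[L]_(n, m)) : hpolmx D Y -> hpolmx D.+1 Y.
Proof. by move=> hY i j; exact: hpolS. Qed.

Lemma pencil_mul_poly n p m (T0 T1 T2 : 'M[K]_(n, p)) (C : 'M[K]_(p, m)) Y1 Y2 :
  pencil T0 T1 T2 *m (cst C + (e *: Y1 + f *: Y2)) =
  cst (T0 *m C) +
    (e *: (cst T0 *m Y1 + cst T1 *m (cst C + (e *: Y1 + f *: Y2))) +
     f *: (cst T0 *m Y2 + cst T2 *m (cst C + (e *: Y1 + f *: Y2)))).
Proof.
set Y := cst C + _; rewrite /pencil !mulmxDl -!scalemxAl.
rewrite [in X in X + _]/Y !mulmxDr !scale_mul_cst map_mxM -addrA; congr (_ + _).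
by rewrite !scalerDr addrACA.
Qed.

Lemma cst_eq0 n m (A : 'M[K]_(n, m)) : cst A = 0 -> A = 0.
Proof. by move=> A0; apply: cst_inj; rewrite A0 map_mx0. Qed.

(** Comparing the Horner components of [T Y = 1] gives [T1 Y = - T0 Y1] and [T2 Y = - T0 Y2]. The
    left inverse [(L1, L2)] recovers [Y] from these with smaller degree; a constant [Y] would be
    killed by [T1] and [T2], hence zero. *)
Lemma no_hpol_inverse D n m (T0 T1 T2 : 'M[K]_(n.+1, m))
    (L1 L2 : 'M[K]_(m, n.+1)) (Y : 'M[L]_(m, n.+1)) :
  L1 *m T1 + L2 *m T2 = 1%:M -> pencil T0 T1 T2 *m Y = 1%:M -> ~ hpolmx D Y.
Proof.
move=> LT; elim: D Y => [|D IH] Y TY hY.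
  have [C CE] := hpolmx0P hY.
  have YE : Y = cst C + (e *: 0 + f *: 0) by rewrite !scaler0 !addr0.
  move: TY; rewrite YE pencil_mul_poly !scaler0 !addr0 !mulmx0 !add0r => /eqP.
  rewrite -subr_eq0 addrAC -cst1 -map_mxB -!map_mxM => /eqP E.
  have [] := hpolmx_eq0 (D := 0) _ _ E.
  - by move=> i j; rewrite mxE; exact: hpol_cst.
  - by move=> i j; rewrite mxE; exact: hpol_cst.
  move=> T0C /cst_eq0 T1C /cst_eq0 T2C.
  have C0 : C = 0.
    by rewrite -[C]mul1mx -LT mulmxDl -!mulmxA T1C T2C !mulmx0 addr0.
  move: T0C; rewrite C0 mulmx0 sub0r => /matrixP/(_ 0 0)/eqP.
  by rewrite !mxE oppr_eq0 oner_eq0.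
have [C [Y1 [Y2 [h1 h2 YE]]]] := hpolmxSP hY.
move: TY; rewrite {1}YE pencil_mul_poly -YE => /eqP.
rewrite -subr_eq0 addrAC -cst1 -map_mxB => /eqP E.
have [||_ E1 E2] := hpolmx_eq0 (D := D.+1) _ _ E.
- apply: hpolmxD; apply: hpolmx_cst_mul => //; exact: hpolmxS.
- apply: hpolmxD; apply: hpolmx_cst_mul => //; exact: hpolmxS.
apply: (IH Y).
  by rewrite YE pencil_mul_poly -YE; apply/eqP; rewrite -subr_eq0 addrAC -cst1
    -map_mxB E.
have -> : Y = cst L1 *m (cst T1 *m Y) + cst L2 *m (cst T2 *m Y).
  by rewrite !mulmxA -!map_mxM -mulmxDl -map_mxD LT cst1 mul1mx.
have F1 : cst T1 *m Y = - (cst T0 *m Y1) by apply/eqP; rewrite -addr_eq0 addrC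
  E1.
have F2 : cst T2 *m Y = - (cst T0 *m Y2) by apply/eqP; rewrite -addr_eq0 addrC
  E2.
rewrite F1 F2.
by apply: hpolmxD; apply: hpolmx_cst_mul; apply: hpolmxN; exact: hpolmx_cst_mul.
Qed.

Definition polymx n m (Y : 'M[L]_(n, m)) := forall i j, poly (Y i j).

Lemma polymxD n m (Y Z : 'M[L]_(n, m)) : polymx Y -> polymx Z -> polymx (Y + Z).
Proof. by move=> hY hZ i j; rewrite mxE; exact: polyD. Qed.

Lemma polymxN n m (Y : 'M[L]_(n, m)) : polymx Y -> polymx (- Y).
Proof. by move=> hY i j; rewrite mxE -scaleN1r; exact: polyZ. Qed.

Lemma polymx_mul_cst n p m (A : 'M[K]_(p, m)) (Y : 'M[L]_(n, p)) :
  polymx Y -> polymx (Y *m cst A).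
Proof.
move=> hY i j; rewrite mxE; apply: poly_sum => k.
by rewrite mxE /= mulr_algr; exact: polyZ.
Qed.

Lemma polymx_cst_wd n m (A : 'M[K]_(n, m)) w : polymx (cst A *m (wd w)%:M).
Proof.
move=> i j; rewrite cst_mul_scalar mul_scalar_mx !mxE /= mulr_algr.
exact/polyZ/poly_wd.
Qed.

Lemma polymx_mul_wd n m (Y : 'M[L]_(n, m)) :
  exists k, forall w : seq bool, (k <= size w)%N -> polymx (Y *m (wd w)%:M).
Proof.
have /choice[F FP] (ij : 'I_n * 'I_m) : exists k, forall w : seq bool,
    (k <= size w)%N -> poly (Y ij.1 ij.2 * wd w).
  exact: genP.
exists (\max_ij F ij) => w sw i j; rewrite mxE.
rewrite (bigD1 j) //= big1 ?addr0 => [|k kj]; last first.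
  by rewrite mxE (negPf kj) mulr0.
rewrite mxE eqxx mulr1n; apply: (FP (i, j)); apply: leq_trans sw.
exact: (leq_bigmax (i, j)).
Qed.

(* With X = A e + B f = T S - 1 the equation Y T = 1 gives Y = S - Y X, hence
   Y = S - S X + ... + Y X^k, and Y X^k is a polynomial for large k. *)
Lemma inverse_polymx n m (T0 T1 T2 : 'M[K]_(n, m)) (S : 'M[K]_(m, n)) Y :
  T0 *m S = 1%:M -> Y *m pencil T0 T1 T2 = 1%:M -> polymx Y.
Proof.
move=> TS YT; pose A := T1 *m S; pose B := T2 *m S.
have YE : Y = cst S - (Y *m cst A *m e%:M + Y *m cst B *m f%:M).
  apply/eqP; rewrite eq_sym subr_eq; apply/eqP.
  rewrite -[LHS]mul1mx -YT -[LHS]mulmxA pencil_mul_cst TS /pencil cst1 !mulmxDr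
    mulmx1.
  by rewrite -!mulmxA !cst_mul_scalar !mul_scalar_mx.
have step (W : 'M[K]_n) w : Y *m cst W *m (wd w)%:M =
    cst (S *m W) *m (wd w)%:M - (Y *m cst (A *m W) *m (wd (false :: w))%:M +
                                 Y *m cst (B *m W) *m (wd (true :: w))%:M).
  have P b (Z : 'M[K]_n) : Y *m cst Z *m (g b)%:M *m cst W *m (wd w)%:M =
      Y *m cst (Z *m W) *m (wd (b :: w))%:M.
    rewrite map_mxM /wd big_cons scalar_mxM -[_ *m (g b)%:M *m _]mulmxA.
    by rewrite -cst_mul_scalar !mulmxA.
  by rewrite {1}YE !mulmxBl !mulmxDl !P (map_mxM _ S W).
have [k kP] := polymx_mul_wd Y.
(* Descent from words of length [k], where the product is polynomial, to the empty word; [W]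
   collects the constant factors that [step] produces. *)
suff desc (j : nat) (w : seq bool) (W : 'M[K]_n) : (j + size w = k)%N -> polymx
  (Y *m cst W *m (wd w)%:M).
  have := desc k [::] 1%:M; rewrite addn0 cst1 mulmx1 /wd big_nil mulmx1.
  by apply.
elim: j w W => [|j IH] w W jw.
  rewrite -mulmxA cst_mul_scalar mulmxA; apply: polymx_mul_cst.
  by apply: kP; rewrite -jw.
rewrite step; apply: polymxD; first exact: polymx_cst_wd.
by apply: polymxN; apply: polymxD; apply: IH; rewrite /= addnS.
Qed.

(* Either T0 has a left kernel and a row is split, or T^-1 is a polynomial, and
   its leading coefficients are killed by T1 and T2; either way a column goes. *)
Theorem good_pencil m n (T0 T1 T2 : 'M[K]_(n, m)) : good (pencil T0 T1 T2).
Proof.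
suff: good_width m by exact.
elim: m {n T0 T1 T2} => [|m IH] [|n] T0 T1 T2 //.
have [/row_freeP[S TS]|] := boolP (row_free T0); last first.
  rewrite -kermx_eq0 => /rowV0Pn[l /sub_kermxP lT0 l0].
  exact: good_split_row l0 lT0.
have [|] := boolP (row_free (col_mx T1 T2)^T); last first.
  rewrite -kermx_eq0 => /rowV0Pn[l /sub_kermxP lT l0].
  have : col_mx T1 T2 *m l^T = 0 by rewrite -[LHS]trmxK trmx_mul trmxK lT trmx0.
  rewrite mul_col_mx -[0]col_mx0 => /eq_col_mx[T1l T2l].
  by apply: (@good_const_col _ _ _ _ _ l^T); rewrite // trmx_eq0.
(* The transpose of [R] is a left inverse of [T1] stacked on [T2]; its two halves serve as [L1] and
   [L2]. *)
move/row_freeP => [R TR] uT; have [Y TY YT] := cl_unit_inv uT.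
have [D hD] := hpolmxP (inverse_polymx TS YT).
exfalso; apply: (no_hpol_inverse (L1 := lsubmx R^T) (L2 := rsubmx R^T) _ TY hD).
rewrite -mul_row_col hsubmxK -[LHS]trmxK trmx_mul trmxK TR.
exact: trmx1.
Qed.

(** * Linearization *)

(* Higman's trick: C + e B1 + f B2 is the Schur complement of a matrix whose
   nonlinear part has smaller degree. *)
Lemma good_poly D n m (T0 T1 T2 : 'M[K]_(n.+1, m.+1)) (B : 'M[L]_(n.+1, m.+1)) :
  hpolmx D B -> good (pencil T0 T1 T2 + B).
Proof.
elim: D n m T0 T1 T2 B => [|D IH] n m T0 T1 T2 B hB.
  have [C ->] := hpolmx0P hB; rewrite /pencil addrAC -map_mxD.
  exact: good_pencil.
have [C [B1 [B2 [h1 h2 ->]]]] := hpolmxSP hB.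
pose q : 'M[L]_(n.+1, n.+1 + n.+1) := row_mx e%:M f%:M.
pose r : 'M[L]_(n.+1 + n.+1, m.+1) := - col_mx B1 B2.
have -> : pencil T0 T1 T2 + (cst C + (e *: B1 + f *: B2)) =
    pencil (T0 + C) T1 T2 - q *m r.
  rewrite mulmxN opprK mul_row_col !mul_scalar_mx addrA; congr (_ + _).
  by rewrite /pencil map_mxD addrAC.
apply: (@unit_selem_border (n + n.+1) n m r q _).1.
have -> : block_mx 1%:M r q (pencil (T0 + C) T1 T2) =
    pencil (block_mx 1%:M 0 0 (T0 + C)) (block_mx 0 0 (row_mx 1%:M 0) T1)
           (block_mx 0 0 (row_mx 0 1%:M) T2) + block_mx 0 r 0 0.
  rewrite !block_mxEv pencil_col !pencil_row !pencil_cst cst1.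
  rewrite [pencil 0 (row_mx _ _) _]/pencil !map_row_mx !map_mx0 cst1.
  rewrite !scale_row_mx !scaler0 !scale_scalar_mx !mulr1 add_row_mx !add0r
    !addr0.
  by rewrite add_col_mx !add_row_mx !addr0 add0r.
refine (IH (n + n.+1 + n.+1)%N (n + n.+1 + m.+1)%N _ _ _ _ _) => i j.
rewrite mxE; case: splitP => i' _; rewrite mxE; case: splitP => j' _; rewrite
  ?mxE.
all: try exact: hpol0.
rewrite -scaleN1r; apply: hpolZ; case: splitP => l _; [exact: h1|exact: h2].
Qed.

(** The splitting matrix divides the first column; the others are divided by the inductive [B],
    placed beside two identity entries. *)
Lemma expand_columns m : exists m' (B : 'M[L]_(m.+1, m'.+1)), selem (cl B) /\
  forall (F : 'rV[L]_m.+1) j', exists j b, (F *m B) 0 j' = F 0 j * g b.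
Proof.
elim: m => [|m [m' [B [NB FB]]]].
  exists 1%N, (row_mx e%:M f%:M : 'M_(1, 1 + 1)); split.
    have := selem_split_row 0; congr (selem (cl _)); apply/matrixP => i j.
    rewrite [i]ord1 [LHS]mxE; case: splitP => [i' _|[]//].
    rewrite [i']ord1 !mxE; case: splitP => j' _; rewrite [j']ord1 // !mxE.
    by case: splitP => [l _|[]//]; rewrite [l]ord1 mxE.
  move=> F j; exists 0; rewrite (@mul_mx_row L 1 1 1 1) mxE.
  case: splitP => l _; rewrite [l]ord1 [F]mx11_scalar -scalar_mxM !mxE eqxx.
    by exists false.
  by exists true.
pose X := col_mx (row_mx e%:M (row_mx f%:M 0)) (row_mx 0 (row_mx 0 1%:M)) :
  'M[L]_(1 + m.+1, 1 + (1 + m.+1)).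
pose B2 := block_mx (1%:M : 'M[L]_1) 0 0 (block_mx (1%:M : 'M[L]_1) 0 0 B).
exists (1 + m'.+1)%N, (X *m B2); split.
  rewrite clM; apply: selemM; first exact: selem_split_row.
  by rewrite /B2 cl_block1 selem_diag cl_block1 selem_diag.
move=> F j; rewrite -[F](@hsubmxK L 1 1 m.+1).
set F0 := lsubmx _; set F1 := rsubmx _.
have E : row_mx F0 F1 *m (X *m B2) =
    row_mx (F0 *m e%:M) (row_mx (F0 *m f%:M) (F1 *m B)) :> 'M_(1, 1 + (1 +
      m'.+1)).
  rewrite mulmxA /X (@mul_row_col L 1 1 m.+1) (@mul_mx_row L 1 1 1 (1 + m.+1)).
  rewrite (@mul_mx_row L 1 1 1 m.+1) (@mul_mx_row L 1 m.+1 1 (1 + m.+1)).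
  rewrite (@mul_mx_row L 1 m.+1 1 m.+1) (@add_row_mx L 1 1 (1 + m.+1)).
  rewrite (@add_row_mx L 1 1 m.+1) !mulmx0 !addr0 !add0r mulmx1 /B2.
  rewrite (@mul_row_block L 1 1 (1 + m.+1)) (@mul_row_block L 1 1 m.+1).
  by rewrite !mulmx0 !mulmx1 !addr0 !add0r.
rewrite E mxE; case: splitP => l _.
  exists (lshift m.+1 (0 : 'I_1)), false; rewrite [l]ord1 (@row_mxEl L 1 1 m.+1
    F0 F1) [F0]mx11_scalar.
  by rewrite -scalar_mxM !mxE eqxx.
rewrite mxE; case: splitP => l' _.
  exists (lshift m.+1 (0 : 'I_1)), true; rewrite [l']ord1 (@row_mxEl L 1 1 m.+1
    F0 F1) [F0]mx11_scalar.
  by rewrite -scalar_mxM !mxE eqxx.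
have [i [b FBE]] := FB F1 l'.
by exists (rshift 1 i), b; rewrite (@row_mxEr L 1 1 m.+1 F0 F1).
Qed.

Lemma long_words_row k : exists m (F : 'rV[L]_m.+1), selem (cl F) /\
  forall j, exists2 w, size w = k & F 0 j = wd w.
Proof.
elim: k => [|k [m [F [NF FP]]]].
  exists 0%N, 1%:M; split; first by rewrite cl1; exact: selem1.
  by move=> j; exists [::]; rewrite // [j]ord1 mxE /wd big_nil.
have [m' [B [NB BP]]] := expand_columns m.
exists m', (F *m B); split; first by rewrite clM; exact: selemM.
move=> j'; have [j [b ->]] := BP F j'; have [w sw ->] := FP j.
exists (rcons w b); first by rewrite size_rcons sw.
by rewrite /wd -cats1 big_cat big_seq1.
Qed.

(** A row [F] of sufficiently long words has trivial class and makes [y F] polynomial, so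
    [good_poly] with the zero pencil applies to [y F]. *)
Theorem unit_selem_all y : unit_selem y.
Proof.
have [k kP] := genP y; have [m [F [NF FP]]] := long_words_row k.
pose A : 'M[L]_(1, m.+1) := y%:M *m F.
have [i j|D hD] := @hpolmxP _ _ A.
  rewrite [i]ord1 /A mul_scalar_mx mxE; have [w sw ->] := FP j.
  by apply: kP; rewrite sw.
have := @good_poly D 0 m 0 0 0 A hD.
rewrite pencil_cst map_mx0 add0r /good clM {1}/cl mul1mx mulmx1 mxE eqxx mulr1n.
by rewrite -[y * _]mul1r mulrA unit_selem_mul //; exact: selem1.
Qed.

Theorem elemL_unitE u : elemL u <-> u \is a GRing.unit.
Proof.
split=> [|uu]; first exact: elemL_unit.
have [v [k [h [uv Gk Gh ->]]]] := unit_diag uu.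
by apply: elemLM Gh; apply: elemLM Gk _; exact: unit_selem_all.
Qed.

End LeavittUnits.

(** * The Leavitt algebra *)

Section PolynomialDepth.

Variable K : fieldType.
Local Notation L := (leavitt K).
Local Notation gen := (@lgen K).
Local Notation gsP := (@leavitt_relations K).

(** The letters of [p] are moved into the word, which thereby only grows longer. *)
Lemma poly_mul_hpol D (y p : L) k :
  (forall w, (k <= size w)%N -> poly gen (y * wd gen w)) -> hpol gen D p ->
  forall w, (k <= size w)%N -> poly gen (y * (p * wd gen w)).
Proof.
elim: D y p => [|D IH] y p hy.
  by move=> [c ->] w sw; rewrite mulr_algl -scalerAr; exact/polyZ/hy.
move=> [c [p1 [p2 [h1 h2 ->]]]] w sw.
rewrite !mulrDl !mulrDr mulr_algl -scalerAr -!(mulrA (gen _) _ (wd _ _))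
  !(mulrA y (gen _)).
apply: polyD; [apply: polyD|]; first exact/polyZ/hy.
  apply: IH h1 _ sw => w' sw'; have := hy (false :: w').
  by rewrite /wd big_cons mulrA; apply; exact: leqW.
apply: IH h2 _ sw => w' sw'; have := hy (true :: w').
by rewrite /wd big_cons mulrA; apply; exact: leqW.
Qed.

Lemma leavitt_mul_word_poly (y : L) :
  exists m, forall w : seq bool, (m <= size w)%N -> poly gen (y * wd gen w).
Proof.
elim/clsW: y; elim=> [b|b|||t [k kP]|t [k kP] u [l lP]|t [k kP] u [l lP]|c t [k
  kP]].
- by exists 0%N => w _; have := poly_wd gen (b :: w); rewrite /wd big_cons.
- exists 1%N => -[//|c w] _; rewrite /wd big_cons.
  have [->|bc] := eqVneq c b; first by rewrite (mulKs gsP); exact: poly_wd.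
  have -> : c = ~~ b by case: (b) (c) bc => -[].
  by rewrite (mul0s gsP); exists 0%N; exact: hpol0.
- by exists 0%N => w _; rewrite -[cls _]/(0 : L) mul0r; exists 0%N; exact:
  hpol0.
- by exists 0%N => w _; rewrite -[cls _]/(1 : L) mul1r; exact: poly_wd.
- exists k => w sw; rewrite -cls_opp -[leavitt_opp _]/(- cls t) mulNr -scaleN1r.
  exact/polyZ/kP.
- exists (maxn k l) => w; rewrite geq_max => /andP[kw lw].
  rewrite -cls_add -[leavitt_add _ _]/(cls t + cls u) mulrDl.
  by apply: polyD; [exact: kP|exact: lP].
(* The first [l] letters turn [u] into a polynomial, and at least [k] letters remain for [t]. *)
- exists (l + k)%N => w sw; rewrite -cls_mul -[leavitt_mul _ _]/(cls t * cls u).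
  rewrite -(cat_take_drop l w) /wd big_cat /= -!/(wd _ _).
  have [|D hD] := lP (take l w); first by rewrite size_takel // (leq_trans _
    sw) ?leq_addr.
  rewrite -mulrA (mulrA (cls u)); apply: (poly_mul_hpol kP hD).
  by rewrite size_drop leq_subRL ?(leq_trans _ sw) ?leq_addr.
- exists k => w sw; rewrite -cls_scale -[leavitt_scale _ _]/(c *: cls t)
  -scalerAl.
  exact/polyZ/kP.
Qed.

Lemma wd_nprefix (a b : word) :
  ~~ prefix a b -> ~~ prefix b a -> wd' (@lstar K) a * wd gen b = 0.
Proof.
elim: a b => [|c a IH] [|d b] //=; rewrite ?prefix0s //.
rewrite /wd' rev_cons -cats1 big_cat big_seq1 /wd big_cons -mulrA.
have [->|cd] := eqVneq c d; first by rewrite (mulKs gsP); exact: IH.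
have -> : d = ~~ c by case: (c) (d) cd => -[].
by rewrite (mul0s gsP) mulr0.
Qed.

End PolynomialDepth.

(** * Leaf sets *)

Section LeafSets.

Variables (K : fieldType) (n : nat) (C : n.-tuple word).
Hypotheses (n2 : (2 <= n)%N) (CP : ordered_leaf_set C).

Local Notation L := (leavitt K).
Local Notation gsP := (@leavitt_relations K).
Local Notation w_ i := (lword K (tnth C i)).
Local Notation w'_ i := (lword_star K (tnth C i)).

(** Otherwise prefix closure would put a child of the leaf [tnth C i] into the tree. *)
Lemma leaf_nprefix i j : i != j -> ~~ prefix (tnth C i) (tnth C j).
Proof.
case: CP => uC [T [_ Tpre _] CT] ij; apply/negP => /prefixP[t jE].
have iT : tnth C i \in leaves T by rewrite -CT mem_tnth.
have jT : tnth C j \in leaves T by rewrite -CT mem_tnth.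
case: t jE => [|c t] jE.
  move: ij; rewrite cats0 in jE; move/eqP: jE.
  by rewrite !(tnth_nth [::]) nth_uniq ?size_tuple // => /eqP/val_inj->;
    rewrite eqxx.
have cT : rcons (tnth C i) c \in T.
  apply: (Tpre _ (tnth C j)); first by rewrite jE -cat_rcons prefix_prefix.
  by move: jT; rewrite !inE => /andP[].
by move: iT cT; rewrite !inE => /and3P[_ /negPf e0 /negPf e1]; clear jE;
  case: c; rewrite ?e0 ?e1.
Qed.

Lemma leaf_orthogonal i j : w'_ i * w_ j = (i == j)%:R.
Proof.
have [->|ij] := eqVneq i j; first exact: (wd'_wd gsP).
by apply: wd_nprefix; apply: leaf_nprefix => //; rewrite eq_sym.
Qed.

Lemma leaf_sum : \sum_(i < n) w_ i * w'_ i = 1.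
Proof.
case: CP => uC [T [T0 Tpre Tfull] CT].
pose x : L := 1 - \sum_(i < n) w_ i * w'_ i.
(* The defect [x] kills every vertex, by induction from the bottom of the tree with [k] bounding the
   remaining height: leaves by orthogonality, inner vertices through their two children. The root
   then gives [x = 0]. *)
suff xT k (h : word) : h \in T -> (\max_(t <- T) size t < size h + k)%N ->
    x * lword K h = 0.
  have := xT (\max_(t <- T) size t).+1 [::] T0 (leqnn _).
  by rewrite /lword big_nil mulr1 => /eqP; rewrite subr_eq0 => /eqP.
elim: k h => [|k IH] h hT.
  by rewrite addn0 ltnNge => /negP[]; exact: leq_bigmax_seq.
move=> hk; have [hl|hl] := boolP (h \in leaves T).
  have /tnthP[i ->] : h \in C by rewrite CT.
  rewrite mulrBl mul1r mulr_suml (bigD1 i) //= -mulrA leaf_orthogonal eqxx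
    mulr1.
  rewrite big1 ?addr0 ?subrr // => j ji.
  by rewrite -mulrA leaf_orthogonal (negPf ji) mulr0.
have {hl} [h0 h1] : rcons h false \in T /\ rcons h true \in T.
  by move: hl; rewrite !inE hT /= (Tfull h hT) andbb negbK.
have child b : rcons h b \in T -> x * lword K h * lgen K b = 0.
  move=> hb; have := IH _ hb; rewrite size_rcons addSnnS => /(_ hk).
  by rewrite {1}/lword -cats1 big_cat big_seq1 mulrA.
by rewrite [LHS](split_sg gsP false) /= !child // !mul0r addr0.
Qed.

(** The root is a prefix of every word, so it cannot be one of two distinct leaves. *)
Lemma leaf_cons i : tnth C i != [::].
Proof.
apply/eqP => iE; have [j ij] : exists j, i != j.
  pose j0 : 'I_n := Ordinal (ltnW n2); pose j1 : 'I_n := Ordinal n2.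
  by have [->|] := eqVneq i j0; [exists j1|exists j0].
by have := leaf_nprefix ij; rewrite iE prefix0s.
Qed.

Let R : 'rV[L]_n := \row_i w_ i.
Let R' : 'cV[L]_n := \col_i w'_ i.

Lemma ThetaE (A : 'M[L]_n) : Theta C A = (R *m A *m R') 0 0.
Proof.
rewrite /Theta mxE exchange_big; apply: eq_bigr => j _.
rewrite !mxE mulr_suml; apply: eq_bigr => i _; by rewrite !mxE.
Qed.

Lemma Theta1 : Theta C (1%:M : 'M[L]_n) = 1.
Proof.
rewrite ThetaE mulmx1 mxE -leaf_sum; apply: eq_bigr => i _.
by rewrite !mxE.
Qed.

Lemma ThetaM (A B : 'M[L]_n) : Theta C (A *m B) = Theta C A * Theta C B.
Proof.
have RR : R' *m R = 1%:M.
  by apply/matrixP => i j; rewrite mxE big_ord1 !mxE leaf_orthogonal.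
rewrite !ThetaE; have -> : R *m (A *m B) *m R' = (R *m A *m R') *m (R *m B *m
  R').
  by rewrite !mulmxA -(mulmxA _ R') RR mulmx1.
by rewrite [LHS]mxE big_ord1.
Qed.

Lemma Theta_elementary i j (a : L) :
  Theta C (1%:M + a *: delta_mx i j) = 1 + w_ i * a * w'_ j.
Proof.
rewrite ThetaE mulmxDr mulmxDl [LHS]mxE -ThetaE Theta1; congr (_ + _).
rewrite -ThetaE /Theta (bigD1 i) //= (bigD1 j) //= !mxE !eqxx mulr1.
rewrite !big1 ?addr0 // => [k ki|k kj].
  by rewrite big1 // => l _; rewrite !mxE (negPf ki) mulr0 mulr0 mul0r.
by rewrite !mxE eqxx (negPf kj) mulr0 mulr0 mul0r.
Qed.

Lemma elementary_group_inv A : elementary_group L n A ->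
  exists B, A *m B = 1%:M /\ B *m A = 1%:M.
Proof.
elim=> {A} [|A [i [j [a [ij ->]]]]|A B _ [A' [AA' A'A]] _ [B' [BB' B'B]]|A B _
  _ AB BA].
- by exists 1%:M; rewrite mulmx1.
- have dd : (a *: delta_mx i j : 'M[L]_n) *m (a *: delta_mx i j) = 0.
    apply/matrixP => k l; rewrite !mxE big1 // => m _; rewrite !mxE.
    have [->|mj] := eqVneq m j; last by rewrite andbF mulr0 mul0r.
    by rewrite (eq_sym j) (negPf ij) !mulr0.
  exists (1%:M - a *: delta_mx i j).
  split; first by rewrite mulmxBr mulmx1 mulmxDl mul1mx dd addr0 addrK.
  by rewrite mulmxBl mul1mx mulmxDr mulmx1 dd addr0 addrK.
- exists (B' *m A'); split.
    by rewrite mulmxA -(mulmxA A) BB' mulmx1.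
  by rewrite mulmxA -(mulmxA B') A'A mulmx1.
- by exists A.
Qed.

Definition Theta_elementary_group : set L := [set Theta C A | A in
  elementary_group L n].

Lemma Theta_elementary_group_mul x y : Theta_elementary_group x ->
  Theta_elementary_group y -> Theta_elementary_group (x * y).
Proof.
move=> [A EA <-] [B EB <-]; exists (A *m B); last exact: ThetaM.
exact: gen_mul.
Qed.

Lemma Theta_elementary_group1 : Theta_elementary_group 1.
Proof. by exists 1%:M; [exact: gen_one | exact: Theta1]. Qed.

Lemma Theta_elementary_group_inv x : Theta_elementary_group x ->
  exists2 y, Theta_elementary_group y & x * y = 1 /\ y * x = 1.
Proof.
move=> [A EA <-]; have [B [AB BA]] := elementary_group_inv EA.
exists (Theta C B); last by rewrite -!ThetaM AB BA Theta1.
by exists B => //; exact: gen_inv AB BA.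
Qed.

(** The first letter of the leaf j kills it against either the right end of [x i j] or the left end
    of [x j k]. Hence all products [x i j * x j k] and all [x i i] vanish, and one plus the sum of
    the terms is the product of the elementary factors. *)
Lemma Theta_elementary_group_transv b a :
  Theta_elementary_group (1 + lgen K b * a * lstar K (~~ b)).
Proof.
pose x i j : L := w'_ i * (lgen K b * a * lstar K (~~ b)) * w_ j.
have zero i : lstar K (~~ b) * w_ i = 0 \/ w'_ i * lgen K b = 0.
  rewrite /lword /lword_star; case: (tnth C i) (leaf_cons i) => [//|c w] _.
  rewrite big_cons rev_cons -cats1 big_cat big_seq1 /=.
  have [->|cb] := eqVneq c b; first by left; rewrite (mul0sN gsP).
  right; have -> : b = ~~ c by case: (c) (b) cb => -[].
  by rewrite -mulrA -[lgen K _]mulr1 (mul0s gsP) mulr0.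
have xx i j k : x i j * x j k = 0.
  have -> : x i j * x j k = w'_ i * lgen K b * a * (lstar K (~~ b) * w_ j) *
      (w'_ j * lgen K b) * (a * lstar K (~~ b) * w_ k) by rewrite /x !mulrA.
  by case: (zero j) => ->; rewrite ?mulr0 !(mulr0, mul0r).
have xii i : x i i = 0.
  have -> : x i i = w'_ i * lgen K b * a * (lstar K (~~ b) * w_ i).
    by rewrite /x !mulrA.
  by case: (zero i) => ->; rewrite !(mulr0, mul0r).
have -> : lgen K b * a * lstar K (~~ b) =
    \sum_(p : 'I_n * 'I_n) w_ p.1 * x p.1 p.2 * w'_ p.2.
  rewrite -(pair_bigA _ (fun i j => w_ i * x i j * w'_ j)) /=.
  rewrite -[LHS]mul1r -[LHS]mulr1 -leaf_sum !mulr_suml; apply: eq_bigr => i _.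
  by rewrite mulr_sumr; apply: eq_bigr => j _; rewrite /x !mulrA.
elim: (index_enum _) => [|p r IH]; first by rewrite big_nil addr0; exact:
  Theta_elementary_group1.
rewrite big_cons; set S := \sum_(p <- r) _.
suff -> : 1 + (w_ p.1 * x p.1 p.2 * w'_ p.2 + S) =
    (1 + w_ p.1 * x p.1 p.2 * w'_ p.2) * (1 + S).
  apply: Theta_elementary_group_mul IH.
  have [pE|pN] := eqVneq p.1 p.2.
    by rewrite pE xii mulr0 mul0r addr0; exact: Theta_elementary_group1.
  exists (1%:M + x p.1 p.2 *: delta_mx p.1 p.2); last exact: Theta_elementary.
  by apply: gen_incl; exists p.1, p.2, (x p.1 p.2).
have S0 : w_ p.1 * x p.1 p.2 * w'_ p.2 * S = 0.
  rewrite /S mulr_sumr big1 // => q _.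
  have -> : w_ p.1 * x p.1 p.2 * w'_ p.2 * (w_ q.1 * x q.1 q.2 * w'_ q.2) =
      w_ p.1 * (x p.1 p.2 * (w'_ p.2 * w_ q.1) * x q.1 q.2) * w'_ q.2.
    by rewrite !mulrA.
  rewrite leaf_orthogonal; have [->|_] := eqVneq p.2 q.1.
    by rewrite mulr1 xx mulr0 mul0r.
  by rewrite mulr0 !mul0r mulr0 mul0r.
by rewrite mulrDl mul1r mulrDr mulr1 S0 addr0 -addrA (addrC S).
Qed.

End LeafSets.

Theorem corollary4p4 (K : fieldType) :
  (forall (n : nat) (C : n.-tuple word),
     (2 <= n)%N -> ordered_leaf_set C ->
     [set u : leavitt K | u \is a GRing.unit] =
       [set Theta C A | A in elementary_group (leavitt K) n]
     /\
     [set Theta C A | A in elementary_group (leavitt K) n] =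
       generated_subgroup
         [set u : leavitt K | exists (i j : 'I_n) (a : leavitt K),
            i != j /\
            u = 1 + lword K (tnth C i) * a * lword_star K (tnth C j)])
  /\
  [set u : leavitt K | u \is a GRing.unit] =
    generated_subgroup
      ([set 1 + lgen K false * a * lstar K true | a in [set: leavitt K]] `|`
       [set 1 + lgen K true * b * lstar K false | b in [set: leavitt K]]).
Proof.
have unitE := elemL_unitE (@leavitt_relations K) (@leavitt_mul_word_poly K).
split; last by apply/predeqP => u; split=> /unitE.
move=> n C n2 CP; set P := [set Theta C A | A in _]; set G :=
  generated_subgroup _.
(* The three sets are compared cyclically: units lie in [P], [P] in [G], and [G] consists of
   units. *)
have unitP u : u \is a GRing.unit -> P u.
  move/unitE; elim=> {u} [|u|u v _ Pu _ Pv|u v _ Pu uv vu].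
  - exact: Theta_elementary_group1.
  - case=> -[a _ <-]; first exact: (Theta_elementary_group_transv n2 CP false).
    exact: (Theta_elementary_group_transv n2 CP true).
  - exact: Theta_elementary_group_mul.
  - have [w Pw [uw wu]] := Theta_elementary_group_inv CP Pu.
    by rewrite -[v]mul1r -wu -mulrA uv mulr1.
have PG u : P u -> G u.
  move=> [A EA <-]; elim: EA => {A} [|A [i [j [a [ij ->]]]]|A B _ GA _ GB|A B _
    GA AB BA].
  - by rewrite Theta1 //; exact: gen_one.
  - by rewrite Theta_elementary //; apply: gen_incl; exists i, j, a.
  - by rewrite -[A * B]/(A *m B) ThetaM //; exact: gen_mul.
  - by apply: gen_inv GA _ _; rewrite -ThetaM // ?[A *m B]AB ?[B *m A]BA Theta1.
have Gunit u : G u -> u \is a GRing.unit.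
  elim=> {u} [|u [i [j [a [ij ->]]]]|u v _ uu _ uv|u v _ _ uv vu].
  - exact: unitr1.
  - have Pu : P (1 + lword K (tnth C i) * a * lword_star K (tnth C j)).
      exists (1%:M + a *: delta_mx i j); last exact: Theta_elementary.
      by apply: gen_incl; exists i, j, a.
    have [w _ [uw wu]] := Theta_elementary_group_inv CP Pu.
    by apply/unitrP; exists w.
  - by rewrite unitrMl.
  - by apply/unitrP; exists u.
split; apply/predeqP => u; split.
- exact: unitP.
- by move/PG/Gunit.
- exact: PG.
- by move/Gunit/unitP.
Qed.
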